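(* Let $M$ be an $\omega_1$-saturated structure (with $T=\mathrm{Th}(M)$ countable) and $G(M)$ a group definable in $M$. Then the universal definable weakly almost periodic ambit of $G(M)$ coincides with the universal definable ambit of $G(M)$, and it can be described as the type space of the collection (algebra) of CL-formulas $F$ on $G$ over $M$ which are stable (for $T$), i.e. as the quotient of $S_G(M)$ by the equivalence relation identifying $p$ and $q$ iff $F(p)=F(q)$ for all such $F$ (with the class of $\mathrm{tp}(e/M)$ as distinguished point).
   Context: $G(M)$ is treated as a discrete group. A $G(M)$-flow is an action of $G(M)$ by homeomorphisms on a compact Hausdorff space; an ambit is a flow with a distinguished point whose orbit is dense. $S_G(M)$ is the space of complete types over $M$ concentrated on $G$, with the natural left action of $G(M)$. Let $\mathfrak C\succ M$ be a monster model and $G=G(\mathfrak C)$. A CL-formula on $G$ over $M$ is a continuous function $F:S_G(M)\to\mathbb R$; for $a\in G$ write $F(a)=F(\mathrm{tp}(a/M))$. $F$ is called stable (for $T$) if the formula $\phi(x,y)=F(yx)$ is stable, i.e. for all $\epsilon>0$ there do not exist $a_i,b_i\in G$ ($i<\omega$) with $|\phi(a_i,b_j)-\phi(a_j,b_i)|\geq\epsilon$ for all $i<j$. A flow $X$ is definable if for every $x\in X$ the map $h:G(M)\to X$, $g\mapsto gx$, is definable: for all disjoint closed $C_1,C_2\subseteq X$ there is a definable (in $M$) $Z\subseteq G(M)$ with $h^{-1}(C_1)\subseteq Z$ and $h^{-1}(C_2)\subseteq G(M)\setminus Z$. A flow $X$ is weakly almost periodic (wap) if for every continuous $f:X\to\mathbb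 R$, every $h\in\mathbb R^X$ in the pointwise closure of $\{x\mapsto f(gx):g\in G(M)\}$ is continuous. The universal definable [wap] ambit is the (unique up to isomorphism) definable [wap] ambit mapping onto every definable [wap] ambit by a continuous $G(M)$-equivariant map preserving distinguished points. *)

(* Defs.v *)
From HB Require Import structures.
From mathcomp Require Import all_boot all_order all_algebra.
From mathcomp Require Import all_classical all_reals all_analysis.

Set Implicit Arguments.
Unset Strict Implicit.
Unset Printing Implicit Defensive.

Import Order.TTheory GRing.Theory Num.Theory.
Import numFieldNormedType.Exports.

Local Open Scope classical_set_scope.
Local Open Scope card_scope.

Record language := Language {
  fsym : countType;
  farity : fsym -> nat;
  rsym : countType;
  rarity : rsym -> nat }.

Record structure (L : language) := Structure {
  dom :> Type;
  dom_inhabited : inhabited dom;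
  finterp : forall f : fsym L, ('I_(farity f) -> dom) -> dom;
  rinterp : forall r : rsym L, ('I_(rarity r) -> dom) -> Prop }.

(** [V] is the type of the variables that may occur free.  A formula with
    parameters from [A] and free variables indexed by [B] is an element of
    [formula L (A + B)], the elements of [A] being interpreted by themselves. *)
Inductive term (L : language) (V : Type) : Type :=
| Var of V
| App (f : fsym L) of ('I_(farity f) -> term L V).

Inductive formula (L : language) (V : Type) : Type :=
| Equ of term L V & term L V
| Rel (r : rsym L) of ('I_(rarity r) -> term L V)
| Bot
| Imp of formula L V & formula L V
| All of formula L (option V).

Arguments Bot {L V}.

HB.instance Definition _ L (V : Type) := gen_eqMixin (formula L V).
HB.instance Definition _ L (V : Type) := gen_choiceMixin (formula L V).
HB.instance Definition _ L (V : Type) := isPointed.Build (formula L V) Bot.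

Section Syntax.
Variable L : language.

Definition Neg (V : Type) (phi : formula L V) : formula L V := Imp phi Bot.
Definition And (V : Type) (phi psi : formula L V) : formula L V :=
  Neg (Imp phi (Neg psi)).
Definition Exi (V : Type) (phi : formula L (option V)) : formula L V :=
  Neg (All (Neg phi)).

Fixpoint trename (V W : Type) (h : V -> W) (t : term L V) : term L W :=
  match t with
  | Var v => Var L (h v)
  | App f ts => App (fun k => trename h (ts k))
  end.

Fixpoint rename (V W : Type) (h : V -> W) (phi : formula L V) : formula L W :=
  match phi with
  | Equ s t => Equ (trename h s) (trename h t)
  | Rel r ts => Rel (fun k => trename h (ts k))
  | Bot => Bot
  | Imp phi psi => Imp (rename h phi) (rename h psi)
  | All phi => All (rename (omap h) phi)
  end.

Definition shiftvar (V : Type) n (v : V + 'I_n.+1) : option V + 'I_n :=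
  match v with
  | inl v => inl (Some v)
  | inr k => if unlift ord0 k is Some k' then inr k' else inl None
  end.

(* existential quantification over an n-tuple *)
Fixpoint Exn (V : Type) n : formula L (V + 'I_n) -> formula L V :=
  match n with
  | 0 => rename (fun v : V + 'I_0 => match v with
                                     | inl v => v
                                     | inr k => False_rect V (notF (ltn_ord k))
                                     end)
  | n'.+1 => fun phi => Exi (Exn (rename (@shiftvar V n') phi))
  end.

End Syntax.

Definition vcat (N V W : Type) (rho : V -> N) (x : W -> N) (v : V + W) : N :=
  match v with inl v => rho v | inr w => x w end.

Section Semantics.
Variables (L : language) (N : structure L).

Fixpoint teval (V : Type) (rho : V -> N) (t : term L V) : N :=
  match t with
  | Var v => rho v
  | App f ts => finterp (fun k => teval rho (ts k))
  end.

Fixpoint sat (V : Type) (phi : formula L V) : (V -> N) -> Prop :=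
  match phi with
  | Equ s t => fun rho => teval rho s = teval rho t
  | Rel r ts => fun rho => rinterp (fun k => teval rho (ts k))
  | Bot => fun _ => False
  | Imp phi psi => fun rho => sat phi rho -> sat psi rho
  | All phi => fun rho => forall x : N, sat phi (fun v => oapp rho x v)
  end.

Lemma sat_Neg (V : Type) (phi : formula L V) rho : sat (Neg phi) rho <-> ~ sat phi rho.
Proof. by []. Qed.

Lemma sat_And (V : Type) (phi psi : formula L V) rho :
  sat (And phi psi) rho <-> sat phi rho /\ sat psi rho.
Proof.
split=> /=; last by move=> [hp hq] H; exact: H.
move=> H; split; apply: contrapT => h; apply: H => //.
Qed.

Lemma sat_Exi (V : Type) (phi : formula L (option V)) rho :
  sat (Exi phi) rho <-> exists x : N, sat phi (fun v => oapp rho x v).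
Proof.
split=> /=; last by case=> x px /(_ x).
by move=> H; apply: contrapT => /forallNP.
Qed.

Lemma teval_rename (V W : Type) (h : V -> W) (rho : W -> N) t :
  teval rho (trename h t) = teval (rho \o h) t.
Proof. by elim: t => //= f ts IH; congr finterp; apply: funext. Qed.

Lemma sat_rename (V W : Type) (h : V -> W) phi (rho : W -> N) :
  sat (rename h phi) rho <-> sat phi (rho \o h).
Proof.
elim: phi W h rho => {V} [V s t|V r ts|V|V p IHp q IHq|V p IHp] W h rho /=.
- by rewrite !teval_rename.
- by under eq_fun do rewrite teval_rename.
- by [].
- by rewrite IHp IHq.
- have E x : sat (rename (omap h) p) (fun v => oapp rho x v)
      <-> sat p (fun v => oapp (rho \o h) x v).
    rewrite IHp; suff -> : (fun v => oapp rho x v) \o omap h =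
      (fun v => oapp (rho \o h) x v) by [].
    by apply: funext; case.
  by split=> H x; apply/E.
Qed.

Lemma sat_Exn (V : Type) n (phi : formula L (V + 'I_n)) rho :
  sat (Exn phi) rho <-> exists x : 'I_n -> N, sat phi (vcat rho x).
Proof.
elim: n V phi rho => [|n IH] V phi rho.
  rewrite [Exn phi]/= sat_rename.
  have E (x : 'I_0 -> N) : rho \o (fun v : V + 'I_0 => match v with
      | inl v => v | inr k => False_rect V (notF (ltn_ord k)) end) = vcat rho x.
    by apply: funext => -[//|[]].
  have k0 (k : 'I_0) : N by case: k.
  by split=> [H|[x]]; [exists k0; rewrite -E|rewrite -E].
have E a (x : 'I_n -> N) : vcat (fun v => oapp rho a v) x \o @shiftvar V n =
    vcat rho (fun k => if unlift ord0 k is Some k' then x k' else a).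
  by apply: funext => -[//|k] /=; case: unlift.
rewrite [Exn phi]/= sat_Exi; split.
  case=> a /IH[x]; rewrite sat_rename E => H.
  by exists (fun k => if unlift ord0 k is Some k' then x k' else a).
case=> x H; exists (x ord0); apply/IH; exists (fun k => x (lift ord0 k)).
rewrite sat_rename E; congr (sat phi (vcat rho _)) : H.
by apply: funext => k; case: unliftP => [j ->|->].
Qed.

Definition finitely_satisfiable (V W : Type) (rho : V -> N) (p : set (formula L (V + W)))
    : Prop :=
  forall s : seq (formula L (V + W)), (forall phi, phi \in s -> p phi) ->
    exists x : W -> N, forall phi, phi \in s -> sat phi (vcat rho x).

Definition realized (V W : Type) (rho : V -> N) (p : set (formula L (V + W))) : Prop :=
  exists x : W -> N, forall phi, p phi -> sat phi (vcat rho x).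

Definition saturated_over (A : set N) : Prop :=
  forall p : set (formula L (A + unit)),
    finitely_satisfiable (fun a : A => \val a) p ->
    realized (fun a : A => \val a) p.

Definition omega1_saturated : Prop :=
  forall A : set N, countable A -> saturated_over A.

(* Cardinals are represented by types: [A] has fewer than [K] elements. *)
Definition smaller_than (K T : Type) (A : set T) : Prop :=
  ~~ ([set: K] #<= A).

Definition saturated (K : Type) : Prop :=
  forall A : set N, smaller_than K A -> saturated_over A.

Definition automorphism (s : N -> N) : Prop :=
  [/\ bijective s,
      forall (f : fsym L) (x : 'I_(farity f) -> N),
        s (finterp x) = finterp (s \o x)
    & forall (r : rsym L) (x : 'I_(rarity r) -> N),
        rinterp (s \o x) <-> rinterp x].

Definition strongly_homogeneous (K : Type) : Prop :=
  forall (A : set N) (h : A -> N), smaller_than K A ->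
    (forall phi : formula L A, sat phi (fun a : A => \val a) <-> sat phi h) ->
    exists s : N -> N, automorphism s /\ forall a : A, s (\val a) = h a.

End Semantics.

(** [C] is an elementary extension of [M], up to the embedding [emb]. *)
Record extension (L : language) (M : structure L) := Extension {
  ext :> structure L;
  emb : M -> ext;
  emb_elementary : forall phi : formula L M, sat phi id <-> sat phi emb }.

Definition monster (L : language) (M : structure L) (C : extension M) : Prop :=
  exists K : Type,
    [/\ smaller_than K [set: M], smaller_than K [set: nat],
        saturated C K & strongly_homogeneous C K].

(** Tuples from an extension of [M] satisfying a formula over [M]; here [i]
    is the interpretation of the parameters. *)
Definition solutions (L : language) (M N : structure L) (i : M -> N) n
    (phi : formula L (M + 'I_n)) : Type :=
  {x : 'I_n -> N | sat phi (vcat i x)}.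

Definition graph_at (L : language) (M N : structure L) (i : M -> N) n
    (phi : formula L (M + ('I_n + 'I_n + 'I_n))) (x y z : 'I_n -> N) : Prop :=
  sat phi (vcat i (vcat (vcat x y) z)).

Record definable_group (L : language) (M : structure L) := DefinableGroup {
  gdim : nat;
  gdom : formula L (M + 'I_gdim);
  gmulf : formula L (M + ('I_gdim + 'I_gdim + 'I_gdim));
  gmul : solutions id gdom -> solutions id gdom -> solutions id gdom;
  gone : solutions id gdom;
  ginv : solutions id gdom -> solutions id gdom;
  gmulP : forall x y z,
    graph_at id gmulf (sval x) (sval y) (sval z) <-> gmul x y = z;
  gmulA : forall x y z, gmul x (gmul y z) = gmul (gmul x y) z;
  gmul1 : forall x, gmul gone x = x;
  gmulV : forall x, gmul (ginv x) x = gone }.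

(* G(M) *)
Definition gpoints (L : language) (M : structure L) (G : definable_group M) :=
  solutions id (gdom G).

(* G(C) *)
Definition epoints (L : language) (M : structure L) (G : definable_group M)
  (C : extension M) := solutions (@emb L M C) (gdom G).

Definition definable_subset (L : language) (M : structure L)
    (G : definable_group M) (Z : set (gpoints G)) : Prop :=
  exists phi : formula L (M + 'I_(gdim G)),
    Z = [set g | sat phi (vcat id (sval g))].

(** A complete type over [M] concentrated on [G]. *)
Record gtype (L : language) (M : structure L) (G : definable_group M) := GType {
  formulas_of :> formula L (M + 'I_(gdim G)) -> Prop;
  gtype_fs : finitely_satisfiable id formulas_of;
  gtype_complete : forall phi, formulas_of phi \/ formulas_of (Neg phi);
  gtype_dom : formulas_of (gdom G) }.

HB.instance Definition _ L M G := gen_eqMixin (@gtype L M G).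
HB.instance Definition _ L M G := gen_choiceMixin (@gtype L M G).

HB.instance Definition _ L M (G : definable_group M) :=
  isSubBaseTopological.Build (@gtype L M G)
    [set: formula L (M + 'I_(gdim G))] (fun phi => [set p : gtype G | p phi]).

Section TypeSpace.
Variables (L : language) (M : structure L) (G : definable_group M).

Lemma elementary_forall (C : extension M) (A : finType)
    (phi : formula L (M + A)) :
  (forall x : A -> M, sat phi (vcat id x)) ->
  forall x : A -> C, sat phi (vcat (@emb _ _ C) x).
Proof.
move=> H x; apply: contrapT => Hx.
pose h (v : M + A) : M + 'I_#|A| :=
  match v with inl m => inl m | inr a => inr (enum_rank a) end.
have E (N : structure L) (i : M -> N) (y : 'I_#|A| -> N) :
    vcat i y \o h = vcat i (y \o enum_rank) by apply: funext => -[].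
have : sat (Exn (rename h (Neg phi))) (@emb _ _ C).
  apply/sat_Exn; exists (x \o enum_val); rewrite sat_rename E.
  rewrite (_ : _ \o _ = x)//.
  by apply: funext => a /=; rewrite enum_rankK.
move=> /emb_elementary/sat_Exn[y]; rewrite sat_rename E; apply.
exact: H.
Qed.

Lemma emul_exists (C : extension M) (x y : epoints G C) :
  exists z : epoints G C,
    graph_at (@emb L M C) (gmulf G) (sval x) (sval y) (sval z).
Proof.
set n := gdim G.
pose h1 (v : M + 'I_n) : M + ('I_n + 'I_n) :=
  match v with inl m => inl m | inr k => inr (inl k) end.
pose h2 (v : M + 'I_n) : M + ('I_n + 'I_n) :=
  match v with inl m => inl m | inr k => inr (inr k) end.
pose h3 (v : M + 'I_n) : (M + ('I_n + 'I_n)) + 'I_n :=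
  match v with inl m => inl (inl m) | inr k => inr k end.
pose h4 (v : M + ('I_n + 'I_n + 'I_n)) : (M + ('I_n + 'I_n)) + 'I_n :=
  match v with
  | inl m => inl (inl m) | inr (inl w) => inl (inr w) | inr (inr k) => inr k
  end.
pose phi := Imp (rename h1 (gdom G)) (Imp (rename h2 (gdom G))
  (Exn (And (rename h3 (gdom G)) (rename h4 (gmulf G))))).
have E (N : structure L) (i : M -> N) (u : 'I_n + 'I_n -> N) :
    sat phi (vcat i u) <-> (sat (gdom G) (vcat i (u \o inl)) ->
      sat (gdom G) (vcat i (u \o inr)) -> exists z : solutions i (gdom G),
        graph_at i (gmulf G) (u \o inl) (u \o inr) (sval z)).
  have E1 : vcat i u \o h1 = vcat i (u \o inl) by apply: funext => -[].
  have E2 : vcat i u \o h2 = vcat i (u \o inr) by apply: funext => -[].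
  have E3 z : vcat (vcat i u) z \o h3 = vcat i z by apply: funext => -[].
  have E4 z : vcat (vcat i u) z \o h4 =
      vcat i (vcat (vcat (u \o inl) (u \o inr)) z).
    by apply: funext => -[//|[[]|]].
  rewrite /phi [sat _ _]/= !sat_rename E1 E2 sat_Exn.
  split=> H d1 d2; have [z] := H d1 d2.
    by rewrite sat_And !sat_rename E3 E4 => -[dz mz]; exists (exist _ z dz).
  move=> mz; exists (sval z); rewrite sat_And !sat_rename E3 E4.
  by split=> //; exact: (svalP z).
have : sat phi (vcat (@emb _ _ C) (vcat (sval x) (sval y))).
  apply: elementary_forall => u; apply/E => d1 d2.
  pose a : gpoints G := exist _ (u \o inl) d1.
  pose b : gpoints G := exist _ (u \o inr) d2.
  by exists (gmul a b); exact/(gmulP a b).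
by move=> /E; apply; [exact: (svalP x)|exact: (svalP y)].
Qed.

Definition emul (C : extension M) (x y : epoints G C) : epoints G C :=
  sval (cid (emul_exists x y)).

Definition tp_formulas (C : extension M) (a : epoints G C) :
    set (formula L (M + 'I_(gdim G))) :=
  [set phi | sat phi (vcat (@emb L M C) (sval a))].

Lemma tp_fs (C : extension M) (a : epoints G C) :
  finitely_satisfiable id (tp_formulas a).
Proof.
move=> s Hs; apply: contrapT => H.
pose psi : formula L (M + 'I_(gdim G)) := foldr (@And L _) (Neg Bot) s.
have psiP (N : structure L) rho : sat psi rho <->
    forall phi, phi \in s -> @sat L N _ phi rho.
  rewrite /psi; elim: s {Hs H psi} => [|f s IH] /=; first by split.
  change (sat (And f (foldr (@And L _) (Neg Bot) s)) rho <->
    forall phi, phi \in f :: s -> @sat L N _ phi rho).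
  rewrite sat_And IH; split=> [[Hf Hs] phi|Hs].
    by rewrite inE => /orP[/eqP ->|/Hs].
  by split=> [|phi ps]; apply: Hs; rewrite inE ?eqxx ?ps ?orbT.
have : sat (Neg psi) (vcat (@emb _ _ C) (sval a)).
  apply: elementary_forall => x /psiP Hx; apply: H; by exists x.
by apply; apply/psiP => phi /Hs.
Qed.

(* tp(a/M) *)
Definition tp (C : extension M) (a : epoints G C) : gtype G :=
  @GType L M G (tp_formulas a) (@tp_fs C a)
    (fun phi => EM (sat phi (vcat (@emb L M C) (sval a)))) (svalP a).

Definition self_extension : extension M :=
  @Extension L M M id (fun phi => iff_refl (sat phi id)).

(* tp(g/M) for g in G(M) *)
Definition tp_point (g : gpoints G) : gtype G := @tp self_extension g.

(** [translate g phi] is the formula phi(gx) of x. *)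
Definition translate (g : gpoints G) (phi : formula L (M + 'I_(gdim G))) :
    formula L (M + 'I_(gdim G)) :=
  let n := gdim G in
  Exn (And
    (rename (fun v : M + 'I_n => match v with
       | inl m => inl (inl m)
       | inr k => inr k
       end : (M + 'I_n) + 'I_n) (And (gdom G) phi))
    (rename (fun v : M + ('I_n + 'I_n + 'I_n) => match v with
       | inl m => inl (inl m)
       | inr (inl (inl k)) => inl (inl (sval g k))
       | inr (inl (inr k)) => inl (inr k)
       | inr (inr k) => inr k
       end : (M + 'I_n) + 'I_n) (gmulf G))).

Lemma sat_translate (g x : gpoints G) phi :
  sat (translate g phi) (vcat id (sval x)) <->
  sat phi (vcat id (sval (gmul g x))).
Proof.
rewrite sat_Exn.
have E1 z : vcat (vcat id (sval x)) z \o (fun v : M + 'I_(gdim G) =>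
    match v with inl m => inl (inl m) | inr k => inr k end) = vcat id z.
  by apply: funext => -[].
have E2 z : vcat (vcat id (sval x)) z \o
    (fun v : M + ('I_(gdim G) + 'I_(gdim G) + 'I_(gdim G)) => match v with
       | inl m => inl (inl m)
       | inr (inl (inl k)) => inl (inl (sval g k))
       | inr (inl (inr k)) => inl (inr k)
       | inr (inr k) => inr k
       end) = vcat id (vcat (vcat (sval g) (sval x)) z).
  by apply: funext => -[//|[[]|]].
split=> [[z]|H].
  rewrite sat_And !sat_rename E1 E2 sat_And => -[[dz pz] mz].
  by rewrite ((gmulP g x (exist _ z dz)).1 mz).
exists (sval (gmul g x)); rewrite sat_And !sat_rename E1 E2 sat_And.
by split; [split=> //; exact: (svalP (gmul g x))|exact/(gmulP g x)].
Qed.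

Lemma gtype_consistent (p : gtype G)
    (s : seq (formula L (M + 'I_(gdim G)))) :
  (forall phi, phi \in s -> p phi) ->
  exists x : gpoints G, forall phi, phi \in s -> sat phi (vcat id (sval x)).
Proof.
move=> Hs; have [|x Hx] := @gtype_fs _ _ _ p (gdom G :: s).
  by move=> phi; rewrite inE => /orP[/eqP ->|/Hs//]; exact: gtype_dom.
have dx : sat (gdom G) (vcat id x) by apply: Hx; rewrite inE eqxx.
by exists (exist _ x dx) => phi ps; apply: Hx; rewrite inE ps orbT.
Qed.

Lemma gact_fs (g : gpoints G) (p : gtype G) :
  finitely_satisfiable id [set phi | p (translate g phi)].
Proof.
move=> s Hs; have [|x Hx] := @gtype_consistent p (map (translate g) s).
  by move=> phi /mapP[psi /Hs + ->].
by exists (sval (gmul g x)) => phi ps; apply/sat_translate/Hx/map_f.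
Qed.

Lemma gact_complete (g : gpoints G) (p : gtype G) phi :
  p (translate g phi) \/ p (translate g (Neg phi)).
Proof.
case: (gtype_complete p (translate g phi)) => [|H1]; first by left.
case: (gtype_complete p (translate g (Neg phi))) => [|H2]; first by right.
have [|x Hx] := @gtype_consistent p
    [:: Neg (translate g phi); Neg (translate g (Neg phi))].
  by move=> psi; rewrite !inE => /orP[]/eqP ->.
have := Hx _ (mem_head _ _); have := Hx (Neg (translate g (Neg phi))).
rewrite !inE eqxx orbT => /(_ isT).
by move=> /sat_Neg + /sat_Neg; rewrite !sat_translate => /sat_Neg.
Qed.

Lemma gact_dom (g : gpoints G) (p : gtype G) : p (translate g (gdom G)).
Proof.
case: (gact_complete g p (gdom G)) => // H.
have [|x /(_ _ (mem_head _ _))] :=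
    @gtype_consistent p [:: translate g (Neg (gdom G))].
  by move=> phi; rewrite inE => /eqP ->.
by rewrite sat_translate => /sat_Neg []; exact: (svalP (gmul g x)).
Qed.

(* phi(x) is in g.p iff phi(gx) is in p *)
Definition gact (g : gpoints G) (p : gtype G) : gtype G :=
  @GType L M G [set phi | p (translate g phi)]
    (@gact_fs g p) (gact_complete g p) (gact_dom g p).

End TypeSpace.

Section Flows.
Variables (R : realType) (L : language) (M : structure L).
Variable G : definable_group M.
Implicit Type X : topologicalType.

Definition is_flow X (act : gpoints G -> X -> X) : Prop :=
  [/\ compact [set: X], hausdorff_space X,
      forall x, act (gone G) x = x,
      forall g h x, act (gmul g h) x = act g (act h x)
    & forall g, continuous (act g)].

Definition is_ambit X (act : gpoints G -> X -> X) (x0 : X) : Prop :=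
  is_flow act /\ dense (range (fun g => act g x0)).

Definition definable_map X (h : gpoints G -> X) : Prop :=
  forall C1 C2 : set X, closed C1 -> closed C2 -> C1 `&` C2 = set0 ->
    exists Z : set (gpoints G), [/\ definable_subset Z,
      h @^-1` C1 `<=` Z & h @^-1` C2 `<=` ~` Z].

Definition definable_flow X (act : gpoints G -> X -> X) : Prop :=
  forall x, definable_map (fun g => act g x).

Definition wap_flow X (act : gpoints G -> X -> X) : Prop :=
  forall f : X -> R, continuous f ->
  forall h : X -> R,
    closure (range (fun g x => f (act g x)) : set {ptws X -> R}) h ->
    continuous h.

Definition definable_ambit X (act : gpoints G -> X -> X) (x0 : X) : Prop :=
  is_ambit act x0 /\ definable_flow act.

Definition definable_wap_ambit X (act : gpoints G -> X -> X) (x0 : X) : Prop :=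
  [/\ is_ambit act x0, definable_flow act & wap_flow act].

Definition ambit_maps_onto X (actX : gpoints G -> X -> X) (x0 : X)
    (Y : topologicalType) (actY : gpoints G -> Y -> Y) (y0 : Y) : Prop :=
  exists f : X -> Y,
    [/\ continuous f, set_surj [set: X] [set: Y] f,
        forall g x, f (actX g x) = actY g (f x) & f x0 = y0].

Definition universal_definable_ambit X (act : gpoints G -> X -> X) (x0 : X)
    : Prop :=
  definable_ambit act x0 /\
  forall (Y : topologicalType) (actY : gpoints G -> Y -> Y) (y0 : Y),
    definable_ambit actY y0 -> ambit_maps_onto act x0 actY y0.

Definition universal_definable_wap_ambit X (act : gpoints G -> X -> X) (x0 : X)
    : Prop :=
  definable_wap_ambit act x0 /\
  forall (Y : topologicalType) (actY : gpoints G -> Y -> Y) (y0 : Y),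
    definable_wap_ambit actY y0 -> ambit_maps_onto act x0 actY y0.

End Flows.

Section StableQuotient.
Variables (R : realType) (L : language) (M : structure L).
Variables (G : definable_group M) (C : extension M).
Local Open Scope ring_scope.
Local Open Scope quotient_scope.

(* CL-formulas on G over M are the continuous functions F : gtype G -> R;
   stability is that of phi(x, y) = F(yx) on G(C). *)
Definition stable_CL (F : gtype G -> R) : Prop :=
  forall eps : R, 0 < eps ->
    ~ exists a b : nat -> epoints G C, forall i j : nat, (i < j)%N ->
        eps <= `|F (tp (emul (b j) (a i))) - F (tp (emul (b i) (a j)))|.

Definition stable_eq (p q : gtype G) : bool :=
  `[< forall F : gtype G -> R, continuous F -> stable_CL F -> F p = F q >].

Lemma stable_eq_refl : reflexive stable_eq.
Proof. by move=> p; apply/asboolP. Qed.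

Lemma stable_eq_sym : symmetric stable_eq.
Proof.
by move=> p q; apply/asboolP/asboolP => H F cF sF; rewrite (H F cF sF).
Qed.

Lemma stable_eq_trans : transitive stable_eq.
Proof.
move=> q p r /asboolP H1 /asboolP H2; apply/asboolP => F cF sF.
by rewrite (H1 F cF sF) (H2 F cF sF).
Qed.

Definition stable_equiv : equiv_rel (gtype G) :=
  EquivRel stable_eq stable_eq_refl stable_eq_sym stable_eq_trans.

Definition stable_space : topologicalType :=
  quotient_topology {eq_quot stable_equiv}.

Definition stable_class (p : gtype G) : stable_space :=
  \pi_({eq_quot stable_equiv}) p.

(* defined through representatives of the classes *)
Definition stable_act (g : gpoints G) (x : stable_space) : stable_space :=
  stable_class (gact g (repr (x : {eq_quot stable_equiv}))).

Definition stable_base : stable_space := stable_class (tp_point (gone G)).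

End StableQuotient.

(* Main.v *)
Require Import Defs.
From HB Require Import structures.
From mathcomp Require Import all_boot all_order all_algebra.
From mathcomp Require Import all_classical all_reals all_analysis.
From mathcomp Require Import lra.
Import Order.TTheory GRing.Theory Num.Theory.
Import numFieldNormedType.Exports.

(** Over an omega1-saturated M every definable ambit is already weakly almost
    periodic.  Let act be a definable flow, x0 one of its points and f a
    continuous function.  If the matrix f (g h x0) on G(M) were unstable, it
    would have two different iterated limits along an ultrafilter; saturation
    yields a point g of G(M) whose row realizes one limit pointwise, whereas
    definability of the orbit map at the limit of the columns forces the other
    one.  By Grothendieck's double limit argument, stability of these matrices
    gives weak almost periodicity.

    The orbit map of a definable ambit extends continuously to the type space,
    and the functions f pulled back to types are stable on G(M), hence on G(C),
    because saturation transfers an unstable pair of sequences of G(C) to G(M).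
    So the extension factors through the quotient by stable functions.
    Conversely that quotient is a definable ambit: for F stable, the limits of
    F(gp) as g tends to a type exist, again by exchanging iterated limits. *)

Set Implicit Arguments.
Unset Strict Implicit.
Unset Printing Implicit Defensive.

Local Open Scope classical_set_scope.

(** * Realizing limits of tuples in a saturated structure *)

Lemma term_support (L : language) (V : Type) (t : term L V) :
  exists (X : finType) (f : X -> V) (t' : term L X),
    forall (N : structure L) (rho : V -> N), teval rho t = teval (rho \o f) t'.
Proof.
elim: t => [v|f ts IH]; first by exists unit, (fun=> v), (Var L tt).
have /choice[s sP] : forall k, exists s : {X : finType & ((X -> V) * term L X)%type},
    forall (N : structure L) (rho : V -> N),
      teval rho (ts k) = teval (rho \o (projT2 s).1) (projT2 s).2.
  by move=> k; have [X [g [t' E]]] := IH k; exists (existT _ X (g, t')).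
exists {k : 'I_(farity f) & projT1 (s k)},
  (fun u => (projT2 (s (tag u))).1 (tagged u)),
  (App (fun k => trename (fun x => Tagged (fun k => projT1 (s k)) x)
    (projT2 (s k)).2)) => N rho /=.
by congr finterp; apply: funext => k; rewrite sP teval_rename.
Qed.

(** Only finitely many variables occur, and one reduced formula serves every structure. For
    variables in [M + W] this means that countably many formulas involve only countably many
    parameters, as omega1-saturation requires. *)
Lemma formula_support (L : language) (V : Type) (phi : formula L V) :
  exists (X : finType) (f : X -> V) (phi' : formula L X),
    forall (N : structure L) (rho : V -> N), sat phi rho <-> sat phi' (rho \o f).
Proof.
elim: phi => {V} [V s t|V r ts|V|V p [X [f [p' Ep]]] q [Y [g [q' Eq]]]
  |V p [X [f [p' Ep]]]].
- have [X [f [s' Es]]] := term_support s; have [Y [g [t' Et]]] := term_support t.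
  exists (X + Y)%type, (fun v => match v with inl x => f x | inr y => g y end),
    (Equ (trename inl s') (trename inr t')) => N rho /=.
  by rewrite !teval_rename Es Et.
- have /choice[s sP] :
    forall k, exists s : {X : finType & ((X -> V) * term L X)%type},
      forall (N : structure L) (rho : V -> N),
        teval rho (ts k) = teval (rho \o (projT2 s).1) (projT2 s).2.
    move=> k; have [X [g [t' E]]] := term_support (ts k).
    by exists (existT _ X (g, t')).
  exists {k : 'I_(rarity r) & projT1 (s k)},
    (fun u => (projT2 (s (tag u))).1 (tagged u)),
    (Rel (fun k => trename (fun x => Tagged (fun k => projT1 (s k)) x)
      (projT2 (s k)).2)) => N rho /=.
  suff -> : (fun k => teval rho (ts k)) = (fun k => teval (rho \o
    (fun u => (projT2 (s (tag u))).1 (tagged u)))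
    (trename (fun x => Tagged (fun k => projT1 (s k)) x) (projT2 (s k)).2)) by [].
  by apply: funext => k; rewrite sP teval_rename.
- by exists void, (of_void V), Bot.
- exists (X + Y)%type, (fun v => match v with inl x => f x | inr y => g y end),
    (Imp (rename inl p') (rename inr q')) => N rho /=.
  by rewrite !sat_rename Ep Eq.
(* Variables that [f] sends to [None] stand for the bound one: [h] collapses them to [None], and
   only the others stay free. *)
- pose X' := {x : X | f x}.
  pose h (x : X) : option X' := insub x.
  have /choice[f' f'P] : forall x : X', exists v, f (val x) = Some v.
    by case=> x /=; case: (f x) => // v _; exists v.
  exists X', f', (All (rename h p')) => N rho /=.
  have E a : (fun v => oapp rho a v) \o f = (fun v => oapp (rho \o f') a v) \o h.
    apply: funext => x /=; rewrite /h; case: insubP => [u fx <-|] /=.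
      by rewrite f'P.
    by case: (f x).
  by split=> H a; have := H a; rewrite Ep sat_rename E.
Qed.

Definition override (T : Type) (x : nat -> T) n y (k : nat) : T :=
  if k == n then y else x k.

(** Dependent choice for conditions on finite prefixes. Stage [n.+1] alters only entry [n], so the
    stages stabilize and their diagonal agrees with stage [n] below [n]. *)
Lemma prefix_recursion (T : Type) (P : nat -> (nat -> T) -> Prop) :
  inhabited T ->
  (forall n x y, (forall k, (k < n)%N -> x k = y k) -> P n x -> P n y) ->
  (forall x, P 0 x) ->
  (forall n x, P n x -> exists y, P n.+1 (override x n y)) ->
  exists x, forall n, P n x.
Proof.
move=> [d] Pext P0 PS.
have /choice[Y YP] : forall nx : nat * (nat -> T), exists y,
    P nx.1 nx.2 -> P nx.1.+1 (override nx.2 nx.1 y).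
  move=> [n x] /=; have [/PS[y]|nP] := EM (P n x); first by exists y.
  by exists d.
pose X := fix X n : nat -> T := if n is m.+1 then override (X m) m (Y (m, X m))
  else fun=> d.
have XP n : P n (X n) by elim: n => [|n IH]; [exact: P0|exact: (YP (n, X n))].
have XE n k : (k < n)%N -> X n k = X k.+1 k.
  elim: n => // n IH; rewrite ltnS leq_eqVlt => /orP[/eqP -> //|kn].
  by rewrite -IH//= /override ltn_eqF.
by exists (fun k => X k.+1 k) => n; exact: Pext (XE n) (XP n).
Qed.

Lemma bump_ord_max n (i : 'I_n.+1.-1) : bump n i = i.
Proof. exact: (@lift_max n i). Qed.

Section Realization.
Variables (L : language) (M : structure L) (hM : omega1_saturated M).
Variables (C : extension M) (J : Type) (U : set_system J) (FU : ProperFilter U).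

(** The tuples [c j] live in [C], their limit is sought in [M]. Prefixes of length [n] appear
    because saturation speaks of one variable, so coordinates must be realized one after another. *)
Definition realizes_limit (A : set M) (c : J -> nat -> C) n (x : nat -> M) :=
  forall phi : formula L (A + 'I_n),
    (\forall j \near U, sat phi (vcat (fun a : A => emb C (val a))
       (fun k : 'I_n => c j k))) ->
    sat phi (vcat (fun a : A => val a) (fun k : 'I_n => x k)).

Lemma realizes_limit0 (A : set M) (c : J -> nat -> C) x : realizes_limit A c 0 x.
Proof.
move=> phi /filter_ex[j].
pose h (v : A + 'I_0) : M := match v with
  | inl a => val a | inr k => False_rect M (notF (ltn_ord k)) end.
have -> : vcat (fun a : A => emb C (val a)) (fun k : 'I_0 => c j k) = emb C \o h.
  by apply: funext => -[a|[]].
rewrite -sat_rename => /emb_elementary/sat_rename.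
congr (sat phi _).
by apply: funext => -[a|[]].
Qed.

(** Adding the [n] elements already found keeps the parameter set countable. A finite part of the
    new one-variable type is implied by one conjunction [Phi] true along [U]. Then [Exi] of [Phi] is
    also true along [U], and [x] satisfies it by assumption. *)
Lemma realizes_limitS (A : set M) (cA : countable A) (c : J -> nat -> C) n x :
  realizes_limit A c n x -> exists y, realizes_limit A c n.+1 (override x n y).
Proof.
move=> Px.
pose A' : set M := \bigcup_(o in [set: option 'I_n])
  (if o is Some k then [set x k] else A).
have cA' : countable A'.
  by apply: bigcup_countable => // -[k|] _ //; exact: countable1.
have A'A (a : A) : A' (val a) by exists None => //; exact: set_valP.
have A'x (k : 'I_n) : A' (x k) by exists (Some k).
pose h (v : A + 'I_n.+1) : A' + unit := match v with
  | inl a => inl (SigSub (mem_set (A'A a)))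
  | inr k => if unlift ord_max k is Some k' then inl (SigSub (mem_set (A'x k')))
             else inr tt
  end.
have hE (u : unit -> M) : vcat (fun a : A' => val a) u \o h =
    vcat (fun a : A => val a) (fun k : 'I_n.+1 => override x n (u tt) k).
  apply: funext => -[a//|k] /=; rewrite /override; case: unliftP => [j ->|->] /=.
    by rewrite bump_ord_max ltn_eqF.
  by rewrite eqxx.
pose g (v : A + 'I_n.+1) : option (A + 'I_n) := match v with
  | inl a => Some (inl a)
  | inr k => omap inr (unlift ord_max k)
  end.
pose Q := [set phi : formula L (A + 'I_n.+1) | \forall j \near U,
  sat phi (vcat (fun a : A => emb C (val a)) (fun k : 'I_n.+1 => c j k))].
have [|u uP] := hM cA' (p := [set rename h phi | phi in Q]).
  move=> s Hs.
  have [Phi QPhi PhiP] : exists2 Phi, Q Phi & forall rho : A' + unit -> M,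
      sat (rename h Phi) rho -> forall psi, psi \in s -> sat psi rho.
    elim: s Hs => [|psi s IH] Hs.
      by exists (Neg Bot) => //; apply: nearW => j; apply/sat_Neg.
    have [|Phi QPhi PhiP] := IH; first by move=> phi ps; apply: Hs; rewrite inE ps orbT.
    have [phi Qphi phiE] := Hs _ (mem_head _ _).
    exists (And phi Phi).
      by apply: filterS2 Qphi QPhi => j sphi sPhi; exact/sat_And.
    move=> rho /sat_rename/sat_And[/sat_rename sphi /sat_rename sPhi] psi'.
    by rewrite inE => /orP[/eqP ->|/PhiP]; [rewrite -phiE|exact].
  have /Px/sat_Exi[y] : \forall j \near U, sat (Exi (rename g Phi))
      (vcat (fun a : A => emb C (val a)) (fun k : 'I_n => c j k)).
    near=> j; apply/sat_Exi; exists (c j n); apply/sat_rename.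
    have : sat Phi (vcat (fun a : A => emb C (val a)) (fun k : 'I_n.+1 => c j k)).
      by near: j; exact: QPhi.
    congr (sat Phi _); apply: funext => -[a//|k] /=.
    by case: unliftP => [i ->|->] //=; rewrite bump_ord_max.
  move=> /sat_rename sPhi; exists (fun=> y) => psi; apply: PhiP.
  apply/sat_rename; rewrite hE; congr (sat Phi _) : sPhi.
  apply: funext => -[a//|k] /=; rewrite /override.
  case: unliftP => [i ->|->] /=; last by rewrite eqxx.
  by rewrite bump_ord_max ltn_eqF.
exists (u tt) => phi Qphi; rewrite -hE; apply/sat_rename; apply: uP.
by exists phi.
Unshelve. all: by end_near.
Qed.

Lemma realize_sequence (A : set M) (cA : countable A) (c : J -> nat -> C) :
  exists x : nat -> M, forall n, realizes_limit A c n x.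
Proof.
apply: prefix_recursion.
- exact: dom_inhabited M.
- move=> n x y E Px phi /Px; congr (sat phi (vcat _ _)).
  by apply: funext => k; rewrite E.
- by move=> x; exact: realizes_limit0.
- by move=> n x; exact: realizes_limitS.
Qed.

Lemma realize_limit (W I : countType) (psi : I -> formula L (M + W))
    (c : J -> W -> C) :
  (forall i, \forall j \near U, sat (psi i) (vcat (emb C) (c j))) ->
  exists x : W -> M, forall i, sat (psi i) (vcat id x).
Proof.
move=> H; have [d] := dom_inhabited C.
have /choice[s sP] : forall i,
    exists s : {X : finType & ((X -> M + W) * formula L X)%type},
    forall (N : structure L) (rho : M + W -> N),
      sat (psi i) rho <-> sat (projT2 s).2 (rho \o (projT2 s).1).
  move=> i; have [X [g [t' E]]] := formula_support (psi i).
  by exists (existT _ X (g, t')).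
pose f i := (projT2 (s i)).1.
pose A : set M := [set m | exists i x, f i x = inl m].
have cA : countable A.
  have -> : A = \bigcup_(i in [set: I]) [set m | exists x, f i x = inl m].
    by apply/seteqP; split=> m [i] => [[x E]|_ [x E]]; exists i => //; exists x.
  apply: bigcup_countable => // i _.
  pose k (x : projT1 (s i)) := if f i x is inl m then Some m else None.
  apply: finite_set_countable.
  have : finite_set ((some : M -> _) @^-1` (k @` [set: projT1 (s i)])).
    apply: finite_preimage; first by move=> ? ? _ _ [].
    exact: finite_image.
  apply: sub_finite_set => m [x E].
  by exists x => //; rewrite /k E.
(* Coordinates are numbered by [pickle]. The filler [d] sits at numbers that code no element of [W],
   which are never read back. *)
have [x xP] := realize_sequence cA
  (fun j k => if unpickle k is Some w then c j w else d).
exists (x \o pickle) => i; apply/sP.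
(* All variables of [psi i] have codes below [n], so a prefix of length [n] suffices for it. *)
pose n := \max_(y : projT1 (s i)) (if f i y is inr w then (pickle w).+1 else 0).
have /choice[g gP] : forall y, exists v : A + 'I_n, match f i y, v with
    | inl m, inl a => val a = m
    | inr w, inr k => k = pickle w :> nat
    | _, _ => False end.
  move=> y; case E: (f i y) => [m|w].
    have Am : A m by exists i, y.
    by exists (inl (SigSub (mem_set Am))).
  have wn : (pickle w < n)%N.
    by rewrite /n (bigD1 y)//= E leq_max leqnn.
  by exists (inr (Ordinal wn)).
have /xP/sat_rename : \forall j \near U, sat (rename g (projT2 (s i)).2)
    (vcat (fun a : A => emb C (val a))
       (fun k : 'I_n => if unpickle k is Some w then c j w else d)).
  near=> j; apply/sat_rename.
  have /sP : sat (psi i) (vcat (emb C) (c j)) by near: j; exact: H.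
  congr sat; apply: funext => y /=; have := gP y; rewrite /f.
  case: (_.1 y) => [m|w]; case: (g y) => [a|k] //=; first by move->.
  by move->; rewrite pickleK.
congr sat; apply: funext => y /=; have := gP y; rewrite /f.
by case: (_.1 y) => [m|w]; case: (g y) => [a|k] //= ->.
Unshelve. all: by end_near.
Qed.

End Realization.

Local Open Scope ring_scope.

(** * Iterated limits *)

Definition stable_matrix (R : realType) (A B : Type) (phi : A -> B -> R) : Prop :=
  forall eps : R, 0 < eps ->
    ~ exists (a : nat -> A) (b : nat -> B), forall i j : nat, (i < j)%N ->
        eps <= `|phi (a i) (b j) - phi (a j) (b i)|.

Lemma stable_matrix_swap (R : realType) (A B : Type) (phi : A -> B -> R) :
  stable_matrix phi -> stable_matrix (fun y x => phi x y).
Proof.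
move=> s eps eps0 [b [a H]]; apply: (s eps eps0); exists a, b => i j ij.
by rewrite distrC; exact: H.
Qed.

(** If [m] does not tend to [alpha], values of [m] at distance at least [eps] from [alpha] occur in
    every set of [V]. Choosing pairs one after another makes [phi (x i) (y j)] close to [l (x i)],
    hence to [alpha], and [phi (x j) (y i)] close to [m (y i)], for [i < j]: an instability. *)
Lemma double_limit (R : realType) (A B : Type) (phi : A -> B -> R)
    (U : set_system A) (V : set_system B) (l : A -> R) (m : B -> R) (alpha : R) :
  ProperFilter U -> ProperFilter V -> stable_matrix phi ->
  (forall x, phi x @ V --> l x) -> (forall y, phi^~ y @ U --> m y) ->
  l @ U --> alpha -> m @ V --> alpha.
Proof.
move=> FU FV st hl hm hal; apply: contrapT => nm.
have [eps eps0 neps] : exists2 eps : R, 0 < eps &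
    ~ \forall y \near V, `|alpha - m y| < eps.
  apply: contrapT => H; apply: nm; apply/cvgrPdist_lt => e e0.
  by apply: contrapT => ?; apply: H; exists e.
have far (S : set B) : V S -> exists2 y, S y & eps <= `|alpha - m y|.
  move=> VS; apply: contrapT => H; apply: neps; apply: filterS VS => y Sy.
  by rewrite ltNge; apply/negP => ?; apply: H; exists y.
(* Three errors below [d] separate the matrix difference from a distance of at least [eps], which
   leaves [d] for the difference itself. *)
pose d := eps / 4; have d0 : 0 < d by rewrite /d divr_gt0.
have [y0 _ _] := far _ filterT; have [x0 _] := filter_ex (@filterT _ U _).
pose good (p : A * B) := `|alpha - l p.1| < d /\ eps <= `|alpha - m p.2|.
pose link (p q : A * B) := `|m p.2 - phi q.1 p.2| < d /\ `|l p.1 - phi p.1 q.2| < d.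
have [|n z z' E|z|n z [g k]|z H] := @prefix_recursion (A * B) (fun n z =>
    (forall i, (i < n)%N -> good (z i)) /\
    (forall i j, (i < j < n)%N -> link (z i) (z j))).
- by constructor; exact: (x0, y0).
- move=> [g k]; split=> [i ilt|i j /andP[ij jn]]; first by rewrite -E//; exact: g.
  by rewrite -!E// ?(ltn_trans ij)//; apply: k; rewrite ij.
- by split=> // i j; rewrite ltn0 andbF.
- have : \forall x \near U, forall i : 'I_n, `|m (z i).2 - phi x (z i).2| < d.
    by apply: filter_forall => i; move/cvgrPdist_lt: (hm (z i).2); exact.
  move/cvgrPdist_lt: hal => /(_ _ d0) /filterI/[apply]/filter_ex[x [xa xm]].
  have : \forall y \near V, forall i : 'I_n, `|l (z i).1 - phi (z i).1 y| < d.
    by apply: filter_forall => i; move/cvgrPdist_lt: (hl (z i).1); exact.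
  move=> /far[y yl ym]; exists (x, y); rewrite /override; split=> [i|i j].
    by rewrite ltnS leq_eqVlt => /orP[/eqP ->|ilt]; rewrite ?eqxx// ltn_eqF// ; exact: g.
  move=> /andP[ij]; rewrite ltnS leq_eqVlt => /orP[/eqP jn|jn].
    rewrite jn eqxx ltn_eqF -?jn//; rewrite jn in ij.
    by split; [exact: (xm (Ordinal ij))|exact: (yl (Ordinal ij))].
  by rewrite !ltn_eqF ?(ltn_trans ij)//; apply: k; rewrite ij.
apply: (st d d0); exists (fun i => (z i).1), (fun i => (z i).2) => i j ij.
have [[gi mi] _] := ((H i.+1).1 i (ltnSn i), tt).
have [h1 h2] := (H j.+1).2 i j (introT andP (conj ij (ltnSn j))).
have h3 : `|alpha - m (z i).2| <= `|alpha - l (z i).1| + `|l (z i).1 - phi (z i).1 (z j).2|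
    + `|phi (z i).1 (z j).2 - phi (z j).1 (z i).2| + `|m (z i).2 - phi (z j).1 (z i).2|.
  rewrite [`|m _ - _|]distrC; apply: le_trans (lerD (lerD (ler_distD _ _ _) (lexx _)) (lexx _)).
  apply: le_trans (lerD (ler_distD _ _ _) (lexx _)).
  exact: ler_distD.
have : d * 4 = eps by rewrite /d divfK.
lra.
Qed.

(** * The space of types *)

Section TypeSpaceTopology.
Variables (L : language) (M : structure L) (G : definable_group M).
Implicit Types (p q : gtype G) (phi psi : formula L (M + 'I_(gdim G))).

Notation holds g phi := (sat phi (vcat id (sval g))).

Lemma gtype_ext p q : (forall phi, p phi <-> q phi) -> p = q.
Proof.
move=> H; have {H} : formulas_of p = formulas_of q.
  by apply: funext => phi; apply/propext.
case: p q => [p p1 p2 p3] [q q1 q2 q3] /= E; subst q.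
by congr GType; exact: Prop_irrelevance.
Qed.

(** A type is finitely satisfiable in G(M), so consequences need testing only at points of G(M). *)
Lemma gtype_entails p (s : seq (formula L (M + 'I_(gdim G)))) psi :
  (forall phi, phi \in s -> p phi) ->
  (forall g : gpoints G, (forall phi, phi \in s -> holds g phi) -> holds g psi) ->
  p psi.
Proof.
move=> ps H; have [//|pn] := gtype_complete p psi.
have [|x xP] := @gtype_consistent _ _ _ p (Neg psi :: s).
  by move=> phi; rewrite inE => /orP[/eqP ->|/ps].
have /sat_Neg[] := xP _ (mem_head _ _).
by apply: H => phi phis; apply: xP; rewrite inE phis orbT.
Qed.

Lemma gtype_sub p phi psi :
  (forall g : gpoints G, holds g phi -> holds g psi) -> p phi -> p psi.
Proof.
move=> H pphi; apply: (@gtype_entails p [:: phi]) => [f|g /(_ _ (mem_head _ _))]; last exact: H.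
by rewrite inE => /eqP ->.
Qed.

Lemma gtypeN p phi : p (Neg phi) <-> ~ p phi.
Proof.
split=> [pn pphi|]; last by case: (gtype_complete p phi).
have [|x xP] := @gtype_consistent _ _ _ p [:: phi; Neg phi].
  by move=> psi; rewrite !inE => /orP[]/eqP ->.
have /sat_Neg[] : holds x (Neg phi) by apply: xP; rewrite !inE eqxx orbT.
by apply: xP; rewrite !inE eqxx.
Qed.

Lemma gtype_And p phi psi : p (And phi psi) <-> p phi /\ p psi.
Proof.
split=> [H|[H1 H2]].
  by split; apply: gtype_sub H => g /sat_And[].
apply: (@gtype_entails p [:: phi; psi]) => [f|g H].
  by rewrite !inE => /orP[]/eqP ->.
by apply/sat_And; split; apply: H; rewrite !inE eqxx ?orbT.
Qed.

Lemma gtypeT p : p (Neg Bot).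
Proof. by apply: (@gtype_entails p [::]) => // g _; exact/sat_Neg. Qed.

(** A finite intersection of subbasic sets is cut out by the conjunction of their formulas. *)
Lemma nbhs_gtypeP p (S : set (gtype G)) :
  nbhs p S <-> exists2 phi, p phi & [set q : gtype G | q phi] `<=` S.
Proof.
rewrite nbhsE; split=> [[Q [[D sD DQ] Qp] QS]|[phi pphi phiS]].
  move: Qp; rewrite -DQ => -[B DB Bp].
  have [F _ BE] := sD _ DB.
  rewrite -BE in Bp.
  exists (foldr (@And L _) (Neg Bot) (finmap.enum_fset F)).
    have : forall phi, phi \in finmap.enum_fset F -> p phi by move=> phi /Bp.
    elim: (finmap.enum_fset F) => [_|f s IH H] /=.
      exact: gtypeT.
    apply/gtype_And; split; first exact: (H _ (mem_head _ _)).
    by apply: IH => phi ps; apply: H; rewrite inE ps orbT.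
  move=> q /= qF; apply: QS; rewrite -DQ; exists B => //.
  suff : (B : set (gtype G)) q by [].
  rewrite -BE.
  suff : forall phi, phi \in finmap.enum_fset F -> q phi by [].
  elim: (finmap.enum_fset F) qF => //= f s IH /gtype_And[qf qs] phi.
  by rewrite inE => /orP[/eqP ->//|/IH]; exact.
exists [set q : gtype G | q phi] => //; split=> //.
exists [set [set q : gtype G | q phi]]; last by rewrite bigcup_set1.
move=> _ ->; exists (finmap.fset1 phi); first by move=> ? _; rewrite inE.
apply/seteqP; split=> q; first by move=> H; apply: H; rewrite /= inE.
by move=> qphi psi; rewrite /= inE => /eqP ->.
Qed.

Lemma nbhs_gtype p phi : p phi -> nbhs p [set q : gtype G | q phi].
Proof. by move=> pphi; apply/nbhs_gtypeP; exists phi. Qed.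

Lemma gtype_cvg T (F : set_system T) {FF : Filter F} (f : T -> gtype G) p :
  (forall phi, p phi -> \forall t \near F, f t phi) -> f @ F --> p.
Proof.
move=> H S /nbhs_gtypeP[phi /H Fphi phiS].
by apply: filterS Fphi => t; exact: phiS.
Qed.

(** An ultrafilter on types converges to the type made of the formulas that belong to almost all
    types. *)
Lemma compact_gtype : compact [set: gtype G].
Proof.
rewrite compact_ultra => U UU _.
pose P phi := U [set p : gtype G | p phi].
have Pfs : finitely_satisfiable (V := M) (W := 'I_(gdim G)) id P.
  move=> s Ps.
  have /filter_ex[p ps] : U [set p : gtype G | forall phi, phi \in s -> p phi].
    elim: s Ps => [_|f s IH Ps]; first by apply: nearW.
    have Us : U [set p : gtype G | forall phi, phi \in s -> p phi].
      by apply: IH => phi ps; apply: Ps; rewrite inE ps orbT.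
    apply: filterS (filterI (Ps f (mem_head _ _)) Us) => p [pf ps] phi.
    by rewrite inE => /orP[/eqP ->|/ps].
  by have [x xs] := gtype_fs ps; exists x.
have Pc phi : P phi \/ P (Neg phi).
  have [|H] := @in_ultra_setVsetC _ _ [set p : gtype G | p phi] UU; [by left|right].
  by apply: filterS H => p /gtypeN.
have Pd : P (gdom G) by apply: nearW => p; exact: gtype_dom.
exists (GType Pfs Pc Pd); split=> // S /nbhs_gtypeP[phi Pphi phiS].
exact: filterS Pphi.
Qed.

Lemma tp_pointE (g : gpoints G) phi : tp_point g phi <-> holds g phi.
Proof. by []. Qed.

Lemma dense_tp_point : dense (range (@tp_point L M G)).
Proof.
move=> O [p Op] oO; have /nbhs_gtypeP[phi pphi phiO] : nbhs p O.
  exact: open_nbhs_nbhs.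
have [|g gphi] := @gtype_consistent _ _ _ p [:: phi].
  by move=> psi; rewrite inE => /eqP ->.
exists (tp_point g); split; last by exists g.
by apply: phiO; apply/tp_pointE; apply: gphi; rewrite inE.
Qed.

Lemma gactE (g : gpoints G) p phi : gact g p phi <-> p (translate g phi).
Proof. by []. Qed.

Lemma gact_tp_point (g h : gpoints G) :
  gact g (tp_point h) = tp_point (gmul g h).
Proof. by apply: gtype_ext => phi; rewrite gactE !tp_pointE sat_translate. Qed.

Lemma gact_one p : gact (gone G) p = p.
Proof.
apply: gtype_ext => phi; rewrite gactE.
by split; apply: gtype_sub => g; rewrite sat_translate gmul1.
Qed.

Lemma gact_mul (g h : gpoints G) p : gact (gmul g h) p = gact g (gact h p).
Proof.
apply: gtype_ext => phi; rewrite !gactE.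
by split; apply: gtype_sub => k; rewrite !sat_translate gmulA.
Qed.

Lemma continuous_gact (g : gpoints G) : continuous (gact g).
Proof.
by move=> p; apply: (@gtype_cvg _ (nbhs p)) => phi /gactE /nbhs_gtype.
Qed.

End TypeSpaceTopology.

(** * Definable maps *)

Definition Or (L : language) (V : Type) (phi psi : formula L V) : formula L V :=
  Neg (And (Neg phi) (Neg psi)).

Lemma sat_Or (L : language) (N : structure L) (V : Type) (phi psi : formula L V)
    (rho : V -> N) : sat (Or phi psi) rho <-> sat phi rho \/ sat psi rho.
Proof.
rewrite /Or sat_Neg sat_And !sat_Neg; split; last by tauto.
by move=> H; apply: contrapT => K; apply: H; split=> ?; apply: K; [left|right].
Qed.

Section DefinableMaps.
Variables (L : language) (M : structure L) (G : definable_group M).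
Implicit Types (p q : gtype G) (phi psi : formula L (M + 'I_(gdim G))).

Notation holds g phi := (sat phi (vcat id (sval g))).

Lemma gtype_Or p phi psi : p (Or phi psi) <-> p phi \/ p psi.
Proof.
rewrite /Or gtypeN gtype_And !gtypeN; split; last by tauto.
by move=> H; apply: contrapT => K; apply: H; split=> ?; apply: K; [left|right].
Qed.

(** The tool for passing from local to global: if no member of the ideal [P] covered everything, the
    complements would generate a proper filter, and a cluster point of it would lie in no member of
    [P]. *)
Lemma gtype_compactness (P : set (formula L (M + 'I_(gdim G)))) :
  P Bot -> (forall phi psi, P phi -> P psi -> P (Or phi psi)) ->
  (forall p, exists2 phi, P phi & p phi) ->
  exists2 phi, P phi & forall p, p phi.
Proof.
move=> P0 PO Pcover; apply: contrapT => H.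
have FF : ProperFilter (filter_from P (fun phi => [set p : gtype G | ~ p phi])).
  apply: filter_from_proper; last first.
    move=> phi Pphi; apply: contrapT => K; apply: H; exists phi => // p.
    by apply: contrapT => np; apply: K; exists p.
  apply: filter_from_filter; first by exists Bot.
  move=> phi psi Pphi Ppsi; exists (Or phi psi); first exact: PO.
  by move=> p /=; rewrite gtype_Or => np; split=> ?; apply: np; [left|right].
have [|q [_ qcl]] := @compact_gtype L M G _ FF; first exact: filterT.
have [phi Pphi qphi] := Pcover q.
have [|r [/= rn rp]] := qcl [set p : gtype G | ~ p phi] _ _ (nbhs_gtype qphi).
  by exists phi.
exact: rn.
Qed.

(** The trace on G(M) of the neighbourhoods of [p]; limits along it are limits as g tends to [p]. *)
Definition tfilter p : set_system (gpoints G) :=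
  filter_from p (fun phi => [set g | holds g phi]).

Global Instance tfilter_proper p : ProperFilter (tfilter p).
Proof.
apply: filter_from_proper; last first.
  move=> phi pphi; have [|g gP] := @gtype_consistent _ _ _ p [:: phi].
    by move=> psi; rewrite inE => /eqP ->.
  by exists g; apply: gP; rewrite inE.
apply: filter_from_filter; first by exists (Neg Bot); exact: gtypeT.
move=> phi psi pphi ppsi; exists (And phi psi); first by rewrite gtype_And.
by move=> g /sat_And.
Qed.

Lemma tfilter_tp_point p : @tp_point L M G @ tfilter p --> p.
Proof. by apply: gtype_cvg => phi pphi; exists phi. Qed.

(** Two distinct cluster points would have neighbourhoods with disjoint closures. A definable set
    separates the preimages of these closures, and [p] decides its formula, which excludes one of
    the two points. *)
Lemma definable_map_cvg (Y : topologicalType) (h : gpoints G -> Y) p :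
  compact [set: Y] -> hausdorff_space Y -> definable_map h ->
  exists y : Y, h @ tfilter p --> y.
Proof.
move=> cY hY dh; have [|y [_ ycl]] := cY (h @ tfilter p) _; first exact: filterT.
exists y; apply: (@compact_cluster_set1 _ _ _ setT hY cY) => //; try exact: filterT.
apply/seteqP; split=> [z zcl|_ -> //]; apply: contrapT => zy.
move: (hY); rewrite open_hausdorff => /(_ z y (introN eqP zy)).
move=> [[A B] /= [/set_mem Az /set_mem By] [oA oB /eqP AB]].
have reg (x : Y) S : open S -> S x -> exists2 D, nbhs x D & closure D `<=` S.
  move=> oS Sx; have [D xD DS] := @compact_regular _ x setT hY cY filterT S
    (open_nbhs_nbhs (conj oS Sx)).
  by exists D.
have [D zD DA] := reg z A oA Az; have [E yE EB] := reg y B oB By.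
have [|_ [[phi ->] DZ EZ]] := dh _ _ (@closed_closure _ D) (@closed_closure _ E).
  by rewrite -subset0 => x [/DA Ax /EB Bx]; rewrite -AB.
have [pphi|pphi] := gtype_complete p phi.
  have [|x [nEx Ex]] := ycl (~` closure E) E _ yE.
    by exists phi => // g gphi Eg; exact: (EZ g Eg).
  by apply: nEx; exact: subset_closure.
have [|x [nDx Dx]] := zcl (~` closure D) D _ zD.
  by exists (Neg phi) => // g /sat_Neg gphi Dg; apply: gphi; exact: DZ.
by apply: nDx; exact: subset_closure.
Qed.

(** The limit at [p] misses [C1] or [C2], so near [p] one of the trivial formulas [Bot] and
    [Neg Bot] separates. Formulas on which some [zeta] separates form an ideal, and compactness
    glues the local choices. *)
Lemma cvg_definable_map (Y : topologicalType) (h : gpoints G -> Y) :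
  (forall p, exists y : Y, h @ tfilter p --> y) -> definable_map h.
Proof.
move=> hcvg C1 C2 cC1 cC2 C12.
pose sep phi := exists zeta : formula L (M + 'I_(gdim G)),
  forall g : gpoints G, holds g phi ->
    (C1 (h g) -> holds g zeta) /\ (C2 (h g) -> ~ holds g zeta).
have [|phi psi [zeta zP] [xi xP]|p|phi [zeta zP] phiT] := @gtype_compactness sep.
- by exists Bot.
- exists (Or (And phi zeta) (And (Neg phi) xi)) => g gor.
  rewrite sat_Or !sat_And sat_Neg.
  have [gphi|gphi] := EM (holds g phi).
    by have [? ?] := zP g gphi; tauto.
  by move/sat_Or: gor => [//|/xP[? ?]]; tauto.
- have [y hy] := hcvg p.
  have local (C : set Y) : closed C -> ~ C y -> exists2 phi, p phi &
      forall g, holds g phi -> ~ C (h g).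
    move=> cC nCy; have [|phi pphi phiC] := hy (~` C); last by exists phi.
    by apply: open_nbhs_nbhs; split=> //; exact: closed_openC.
  have [C1y|C1y] := EM (C1 y).
    have [|phi pphi phiC] := local C2 cC2.
      by move=> C2y; have : (C1 `&` C2) y by []; rewrite C12.
    by exists phi => //; exists (Neg Bot) => g /phiC; split=> // _; exact/sat_Neg.
  have [phi pphi phiC] := local C1 cC1 C1y.
  by exists phi => //; exists Bot => g /phiC nC1; split=> [//|_ []].
have gP (g : gpoints G) : holds g phi := phiT (tp_point g).
exists [set g | holds g zeta]; split; first by exists zeta.
  by move=> g; exact: (zP g (gP g)).1.
by move=> g; exact: (zP g (gP g)).2.
Qed.

(** The extension takes limits along [tfilter p]. A formula of [p] that forces values into [D] puts
    the limits at all types containing it into the closure of [D]; regularity of [Y] then gives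
    continuity. *)
Lemma definable_map_extension (Y : topologicalType) (h : gpoints G -> Y) :
  compact [set: Y] -> hausdorff_space Y -> definable_map h ->
  exists2 H : gtype G -> Y, continuous H & forall g, H (tp_point g) = h g.
Proof.
move=> cY hY dh.
have /choice[H HP] := fun p => definable_map_cvg p cY hY dh.
exists H => [p S nS|g].
  have [D nD DS] := @compact_regular _ (H p) setT hY cY filterT S nS.
  have [phi pphi phiD] := HP p _ nD.
  apply/nbhs_gtypeP; exists phi => // q qphi; apply: DS => B nB.
  have [psi qpsi psiB] := HP q _ nB.
  have /filter_ex[g [gphi gpsi]] :
      tfilter q ([set g | holds g phi] `&` [set g | holds g psi]).
    by apply: filterI; [exists phi|exists psi].
  by exists (h g); split; [exact: phiD|exact: psiB].
symmetry; apply: hY => A B nA /(HP (tp_point g))[phi gphi phiB].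
by exists (h g); split; [exact: nbhs_singleton|exact: phiB].
Qed.

End DefinableMaps.

(** * Definable flows *)

Lemma compact_ultra_cvg (Y : topologicalType) (J : Type) (U : set_system J)
    (u : J -> Y) : compact [set: Y] -> UltraFilter U -> exists y : Y, u @ U --> y.
Proof.
move=> cY UU; have [|y [_ ycl]] := cY (u @ U) _; first exact: filterT.
exists y => S yS; have [//|nS] := @in_ultra_setVsetC _ _ (u @^-1` S) UU.
by have [|z []] := ycl (~` S) S _ yS.
Qed.

Section DefinableFlows.
Variables (R : realType) (L : language) (M : structure L).
Variable G : definable_group M.

Lemma definable_flow_realize (hM : omega1_saturated M) (Y : topologicalType)
    (act : gpoints G -> Y -> Y) (f : Y -> R) (I : countType) (J : Type)
    (U : set_system J) (x : I -> Y) (b : J -> gpoints G) (v : I -> R) (d : R) :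
  definable_flow act -> continuous f -> ProperFilter U -> 0 < d ->
  (forall i, f (act (b j) (x i)) @[j --> U] --> v i) ->
  exists g, forall i, `|v i - f (act g (x i))| < d.
Proof.
move=> dY cf FU d0 bv.
have cdist r : continuous (fun y => `|r - f y|).
  by move=> y; apply: cvg_norm; apply: cvgB; [exact: cvg_cst|exact: cf].
(* The gap between [d / 2] and [d] leaves room for a definable set, which replaces the metric
   condition by a formula that saturation can handle. *)
have /choice[zeta zP] : forall i, exists zeta : formula L (M + 'I_(gdim G)),
    forall g : gpoints G,
    (`|v i - f (act g (x i))| <= d / 2 -> sat zeta (vcat id (sval g))) /\
    (sat zeta (vcat id (sval g)) -> `|v i - f (act g (x i))| < d).
  move=> i; have [|||_ [[zeta ->] Z1 Z2]] := dY (x i)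
      [set y | `|v i - f y| <= d / 2] [set y | d <= `|v i - f y|].
  - apply: (@closed_comp _ _ (fun y => `|v i - f y|) [set r | r <= d / 2]).
      by move=> y _; exact: cdist.
    exact: closed_le.
  - apply: (@closed_comp _ _ (fun y => `|v i - f y|) [set r | d <= r]).
      by move=> y _; exact: cdist.
    exact: closed_ge.
  - by rewrite -subset0 => y [/= h1 h2]; lra.
  exists zeta => g; split; first exact: (Z1 g).
  by move=> gz; rewrite ltNge; apply/negP => /(Z2 g).
(* The extra index [None] carries the condition that the realized tuple lies in the group. *)
have [|g gP] := @realize_limit L M hM (self_extension M) J U _ 'I_(gdim G)
    (option I) (fun o => if o is Some i then zeta i else gdom G)
    (fun j => sval (b j)).
  case=> [i|]; last by apply: nearW => j; exact: (svalP (b j)).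
  have d2 : 0 < d / 2 by lra.
  move/cvgrPdist_le: (bv i) => /(_ _ d2); apply: filterS => j.
  exact: (zP i (b j)).1.
pose g' : gpoints G := exist _ g (gP None).
by exists g' => i; exact: (zP i g').2 (gP (Some i)).
Qed.

(* An instability matrix f (a_i b_j y) has iterated limits [l i], [m j] along
   an ultrafilter with |l i - m i| >= eps.  Saturation provides [g] with
   f (g b_j y) close to [m j] for all [j], and f (g z) close to the limit of
   [l], where z is the limit of the points b_j y. *)
Lemma definable_flow_stable (hM : omega1_saturated M) (Y : topologicalType)
    (act : gpoints G -> Y -> Y) (f : Y -> R) (y0 : Y) :
  is_flow act -> definable_flow act -> continuous f ->
  stable_matrix (fun g h : gpoints G => f (act (gmul g h) y0)).
Proof.
move=> [cY _ _ actM cact] dY cf eps eps0 [a [b H]].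
have [U [UU Uoo]] := @ultraFilterLemma nat \oo _.
have [z bz] := compact_ultra_cvg (fun j => act (b j) y0) cY UU.
have [w aw] := compact_ultra_cvg (fun i => act (a i) z) cY UU.
have /choice[t tP] := fun j => compact_ultra_cvg
  (fun i => act (gmul (a i) (b j)) y0) cY UU.
(* [None] adds the limit point [z] to the columns, so that a single [g] controls the columns and
   their limit. The chain from [f (act (a j) z)] to [f (t j)] through [f w], [f (act g z)] and
   [f (act g (act (b j) y0))] has four links, hence [eps / 4]. *)
pose x (o : option nat) := if o is Some j then act (b j) y0 else z.
pose v (o : option nat) := f (if o is Some j then t j else w).
have d0 : 0 < eps / 4 by lra.
have [|g gP] := @definable_flow_realize hM Y act f (option nat) nat U x a v
    (eps / 4) dY cf _ d0.
  case=> [j|]; last exact: cvg_comp aw (cf w).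
  under eq_fun do rewrite /= -actM.
  exact: cvg_comp (tP j) (cf (t j)).
have far i : eps <= `|f (act (a i) z) - f (t i)|.
  have lim1 : f (act (gmul (a i) (b j)) y0) @[j --> U] --> f (act (a i) z).
    under eq_fun do rewrite actM.
    exact: cvg_comp (cvg_comp _ _ bz (cact (a i) z)) (cf _).
  have lim2 : f (act (gmul (a j) (b i)) y0) @[j --> U] --> f (t i).
    exact: cvg_comp (tP i) (cf (t i)).
  have lim : `|f (act (gmul (a i) (b j)) y0) - f (act (gmul (a j) (b i)) y0)|
      @[j --> U] --> `|f (act (a i) z) - f (t i)|.
    by apply: cvg_norm; exact: cvgB lim1 lim2.
  apply: cvgr_to_ge lim _; apply: Uoo; exists i.+1 => // j /= ij.
  exact: H.
have lim_g : f (act g (act (b j) y0)) @[j --> U] --> f (act g z).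
  exact: cvg_comp (cvg_comp _ _ bz (cact g z)) (cf _).
have lim_l : f (act (a i) z) @[i --> U] --> f w by exact: cvg_comp aw (cf w).
have /filter_ex[j [h1 h2]] : \forall j \near U,
    `|f (act g z) - f (act g (act (b j) y0))| < eps / 4 /\
    `|f w - f (act (a j) z)| < eps / 4.
  near=> j; split; near: j.
    by move/cvgrPdist_lt: lim_g; exact.
  by move/cvgrPdist_lt: lim_l; exact.
have h3 : `|f w - f (act g z)| < eps / 4 := gP None.
have h4 : `|f (t j) - f (act g (act (b j) y0))| < eps / 4 := gP (Some j).
have h5 := far j; move: h1 h2 h3 h4 h5.
rewrite !ltr_norml ler_normr => /andP[? ?] /andP[? ?] /andP[? ?] /andP[? ?] /orP[] ?; lra.
Unshelve. all: by end_near.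
Qed.

(** [h] is the limit of the translates of [f] along [U], and [V x] collects the group elements that
    move [x0] close to [x]. Exchanging the two limits shows that [h] along the orbit of [x0] tends
    to [h x]; density of the orbit extends this to all points near [x]. *)
Lemma stable_wap (X : topologicalType) (act : gpoints G -> X -> X) (x0 : X) :
  is_ambit act x0 ->
  (forall f : X -> R, continuous f ->
    stable_matrix (fun g h : gpoints G => f (act (gmul g h) x0))) ->
  wap_flow R act.
Proof.
move=> [[_ _ _ actM cact] dx0] st f cf h hcl.
pose U := filter_from (nbhs (h : {ptws X -> R}))
  (fun B => [set g | B (fun x => f (act g x))]).
have FU : ProperFilter U.
  apply: filter_from_proper => [|B /hcl[_ [[g _ <-] Bg]]]; last by exists g.
  apply: filter_from_filter; first by exists setT; exact: filterT.
  by move=> B B' nB nB'; exists (B `&` B') => //; exact: filterI.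
have Uh x : f (act g x) @[g --> U] --> h x.
  move=> S nS; exists [set k : {ptws X -> R} | S (k x)] => //.
  have /pointwise_cvgP/(_ x) : {ptws, nbhs (h : {ptws X -> R}) --> h} by [].
  exact.
pose V (x : X) := filter_from (nbhs x) (fun B => [set a | B (act a x0)]).
have FV x : ProperFilter (V x).
  apply: filter_from_proper => [|B /nbhs_interior nB].
    apply: filter_from_filter; first by exists setT; exact: filterT.
    by move=> B B' nB nB'; exists (B `&` B') => //; exact: filterI.
  have [|z [Bz [g _ E]]] := dx0 B° _ (open_interior B).
    by exists x; exact: nbhs_singleton.
  by exists g; rewrite /= E; exact: interior_subset.
have Vh x : h (act a x0) @[a --> V x] --> h x.
  apply: (@double_limit R _ _ (fun g a => f (act (gmul g a) x0)) U (V x)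
    (fun g => f (act g x)) _ (h x) FU (FV x) _ _ _ (Uh x)); first exact: st.
    move=> g; rewrite (_ : (fun a => _) = fun a => f (act g (act a x0))); last first.
      by apply: funext => a; rewrite actM.
    have Vx : act a x0 @[a --> V x] --> x by move=> S nS; exists S.
    exact: cvg_comp (cvg_comp _ _ Vx (cact g x)) (cf _).
  move=> a; rewrite (_ : (fun g => _) = fun g => f (act g (act a x0))); first exact: Uh.
  by apply: funext => g; rewrite actM.
move=> x; apply/cvgrPdist_lt => e e0.
have e2 : 0 < e / 2 by lra.
have Vd z : \forall a \near V z, `|h z - h (act a x0)| < e / 2.
  by move/cvgrPdist_lt: (Vh z); exact.
have [B /nbhs_interior nB Be] := Vd x.
(* An orbit point taken close to [z] still lies in [B], so its value under [h] is within [e / 2] of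
   both [h x] and [h z]. *)
near=> z; have /filter_ex[a [Ba az]] : \forall a \near V z,
    B (act a x0) /\ `|h z - h (act a x0)| < e / 2.
  apply: filterI (Vd z); exists B => //.
  by near: z.
move: az (Be _ Ba) => /=.
rewrite !ltr_norml => /andP[? ?] /andP[? ?]; lra.
Unshelve. all: by end_near.
Qed.

Lemma definable_ambit_wap (hM : omega1_saturated M) (X : topologicalType)
    (act : gpoints G -> X -> X) (x0 : X) :
  definable_ambit act x0 -> definable_wap_ambit R act x0.
Proof.
move=> [ax dX]; split=> //; apply: (stable_wap ax) => f cf.
have [fX _] := ax; exact: definable_flow_stable hM _ _ _ _ fX dX cf.
Qed.

End DefinableFlows.

(** * Stability on the points of G *)

Section Products.
Variables (L : language) (M : structure L) (G : definable_group M).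
Variable C : extension M.
Let n := gdim G.

Lemma emb_sat (W : Type) (phi : formula L (M + W)) (x : W -> M) :
  sat phi (vcat id x) <-> sat phi (vcat (emb C) (emb C \o x)).
Proof.
have -> : vcat (emb C) (emb C \o x) = emb C \o vcat id x.
  by apply: funext => -[].
rewrite -sat_rename -emb_elementary sat_rename.
by split; congr (sat phi _); apply: funext.
Qed.

(* The formula phi(xy) of (x, y). *)
Definition product_formula (phi : formula L (M + 'I_n)) :
    formula L (M + ('I_n + 'I_n)) :=
  Exn (And
    (rename (fun v : M + 'I_n => match v with
       | inl m => inl (inl m)
       | inr k => inr k
       end : (M + ('I_n + 'I_n)) + 'I_n) (And (gdom G) phi))
    (rename (fun v : M + ('I_n + 'I_n + 'I_n) => match v with
       | inl m => inl (inl m)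
       | inr (inl w) => inl (inr w)
       | inr (inr k) => inr k
       end : (M + ('I_n + 'I_n)) + 'I_n) (gmulf G))).

Lemma sat_product_formula (N : structure L) (i : M -> N) phi (x y : 'I_n -> N) :
  sat (product_formula phi) (vcat i (vcat x y)) <->
  exists z, [/\ sat (gdom G) (vcat i z), sat phi (vcat i z) &
    graph_at i (gmulf G) x y z].
Proof.
have E1 z : vcat (vcat i (vcat x y)) z \o (fun v : M + 'I_n =>
    match v with inl m => inl (inl m) | inr k => inr k end) = vcat i z.
  by apply: funext => -[].
have E2 z : vcat (vcat i (vcat x y)) z \o
    (fun v : M + ('I_n + 'I_n + 'I_n) => match v with
       | inl m => inl (inl m)
       | inr (inl w) => inl (inr w)
       | inr (inr k) => inr k
       end) = vcat i (vcat (vcat x y) z).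
  by apply: funext => -[//|[[]|]].
rewrite sat_Exn; split=> -[z].
  by rewrite sat_And !sat_rename E1 E2 sat_And => -[[dz pz] mz]; exists z.
by move=> [dz pz mz]; exists z; rewrite sat_And !sat_rename E1 E2 sat_And.
Qed.

Lemma product_formulaM (g h : gpoints G) phi :
  sat (product_formula phi) (vcat id (vcat (sval g) (sval h))) <->
  sat phi (vcat id (sval (gmul g h))).
Proof.
rewrite sat_product_formula; split=> [[z [dz pz]]|H].
  by move=> /(gmulP g h (exist _ z dz)) ->.
exists (sval (gmul g h)); split=> //; first exact: svalP (gmul g h).
exact/(gmulP g h).
Qed.

(** That [gmulf] is single-valued on the group is first-order and passes from [M] to [C], one
    coordinate [k] at a time. This makes the witness chosen by [emul] unambiguous. *)
Lemma product_unique (x y z z' : epoints G C) :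
  graph_at (emb C) (gmulf G) (sval x) (sval y) (sval z) ->
  graph_at (emb C) (gmulf G) (sval x) (sval y) (sval z') -> z = z'.
Proof.
move=> gz gz'; suff E : sval z = sval z'.
  by case: z z' E {gz gz'} => [z ?] [z' ?] /= E; subst z'; congr exist; exact: Prop_irrelevance.
apply: funext => k.
pose A : finType := ('I_n + 'I_n + ('I_n + 'I_n))%type.
pose one (f : 'I_n -> A) (v : M + 'I_n) : M + A :=
  match v with inl m => inl m | inr j => inr (f j) end.
pose three (f : 'I_n -> 'I_n + 'I_n) (v : M + ('I_n + 'I_n + 'I_n)) : M + A :=
  match v with
  | inl m => inl m | inr (inl w) => inr (inl w) | inr (inr j) => inr (inr (f j))
  end.
pose phi := Imp (rename (one (inl \o inl)) (gdom G))
  (Imp (rename (one (inl \o inr)) (gdom G))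
  (Imp (rename (one (inr \o inl)) (gdom G))
  (Imp (rename (one (inr \o inr)) (gdom G))
  (Imp (rename (three inl) (gmulf G)) (Imp (rename (three inr) (gmulf G))
  (Equ (Var L (inr (inr (inl k)))) (Var L (inr (inr (inr k)))))))))).
have E1 (N : structure L) (i : M -> N) u f : vcat i u \o one f = vcat i (u \o f).
  by apply: funext => -[].
have E3 (N : structure L) (i : M -> N) u f : vcat i u \o three f =
    vcat i (vcat (vcat (u \o inl \o inl) (u \o inl \o inr)) (u \o inr \o f)).
  by apply: funext => -[//|[[]|]].
have : sat phi (vcat (emb C) (vcat (vcat (sval x) (sval y)) (vcat (sval z) (sval z')))).
  apply: elementary_forall => u /=; rewrite !sat_rename !E1 !E3.
  move=> d1 d2 d3 d4.
  pose x1 : gpoints G := exist _ (u \o (inl \o inl)) d1.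
  pose x2 : gpoints G := exist _ (u \o (inl \o inr)) d2.
  pose x3 : gpoints G := exist _ (u \o (inr \o inl)) d3.
  pose x4 : gpoints G := exist _ (u \o (inr \o inr)) d4.
  move=> /(gmulP x1 x2 x3) m3 /(gmulP x1 x2 x4).
  by rewrite m3 => /(congr1 sval)/(congr1 (fun f => f k)).
rewrite /= !sat_rename !E1 !E3.
by apply; [exact: (svalP x)|exact: (svalP y)|exact: (svalP z)|exact: (svalP z')
  |exact: gz|exact: gz'].
Qed.

Lemma product_formulaC (x y : epoints G C) phi :
  sat (product_formula phi) (vcat (emb C) (vcat (sval x) (sval y))) <->
  tp (emul x y) phi.
Proof.
have gxy : graph_at (emb C) (gmulf G) (sval x) (sval y) (sval (emul x y)).
  exact: svalP (cid (emul_exists x y)).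
rewrite sat_product_formula; split=> [[z [dz pz gz]]|H].
  by rewrite (@product_unique x y (emul x y) (exist _ z dz)).
by exists (sval (emul x y)); split=> //; exact: svalP (emul x y).
Qed.

Definition embed_point (g : gpoints G) : epoints G C :=
  exist _ (emb C \o sval g) ((emb_sat (gdom G) (sval g)).1 (svalP g)).

Lemma tp_emul_embed (g h : gpoints G) :
  tp (emul (embed_point g) (embed_point h)) = tp_point (gmul g h).
Proof.
apply: gtype_ext => phi.
rewrite -product_formulaC tp_pointE -product_formulaM emb_sat.
by split; congr (sat _ _); apply: funext => -[//|[]].
Qed.

End Products.

Section Transfer.
Variables (R : realType) (L : language) (M : structure L).
Variables (G : definable_group M) (C : extension M).

Definition stable_on_points (F : gtype G -> R) : Prop :=
  stable_matrix (fun g h : gpoints G => F (tp_point (gmul g h))).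

(** Uniform continuity: around each type one formula keeps [F] within [d / 2] of its value there,
    and finitely many such formulas cover the type space. *)
Lemma small_oscillation (F : gtype G -> R) (d : R) : continuous F -> 0 < d ->
  exists s : seq (formula L (M + 'I_(gdim G))), forall p q : gtype G,
    (forall phi, phi \in s -> p phi -> q phi) -> `|F p - F q| < d.
Proof.
move=> cF d0.
pose small phi := exists s : seq (formula L (M + 'I_(gdim G))),
  forall p q : gtype G, p phi ->
    (forall psi, psi \in s -> p psi -> q psi) -> `|F p - F q| < d.
have [|phi psi [s sP] [t tP]|p|phi [s sP] phiT] := @gtype_compactness _ _ G small.
- exists [::] => p q pB _.
  by have /gtypeN[] := gtypeT p.
- exists (s ++ t) => p q /gtype_Or[pphi|ppsi] H.
    by apply: sP => // f fs; apply: H; rewrite mem_cat fs.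
  by apply: tP => // f ft; apply: H; rewrite mem_cat ft orbT.
- have d2 : 0 < d / 2 by lra.
  have /nbhs_gtypeP[phi pphi phiP] : nbhs p [set q | `|F p - F q| < d / 2].
    by move/cvgrPdist_lt: (cF p); exact.
  exists phi => //; exists [:: phi] => q r qphi H.
  have rphi : r phi by apply: H => //; rewrite inE.
  move: (phiP q qphi) (phiP r rphi) => /=.
  rewrite !ltr_norml => /andP[? ?] /andP[? ?]; lra.
by exists s => p q; exact: sP.
Qed.

Lemma stable_CL_on_points (F : gtype G -> R) :
  stable_CL C F -> stable_on_points F.
Proof.
move=> sF eps eps0 [a [b H]]; apply: (sF eps eps0).
(* [stable_CL] evaluates [F] at yx, so the two sequences exchange roles. *)
exists (embed_point C \o b), (embed_point C \o a) => i j ij.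
by rewrite /= !tp_emul_embed distrC; exact: H.
Qed.

(** Up to [eps / 4], the values of [F] at the products [b j] [a i] depend on which formulas of the
    finite list [s] hold there. These are countably many conditions on the two sequences together,
    so sequences in G(M) satisfy them too. *)
Lemma stable_on_points_CL (hM : omega1_saturated M) (F : gtype G -> R) :
  continuous F -> stable_on_points F -> stable_CL C F.
Proof.
move=> cF sF eps eps0 [a [b H]].
have d0 : 0 < eps / 4 by lra.
have [s sP] := small_oscillation cF d0.
pose n := gdim G.
pose W : countType := (nat * bool * 'I_n)%type.
pose I : countType := ((nat * bool) + (nat * nat * 'I_(size s)))%type.
pose phi (ijk : nat * nat * 'I_(size s)) : formula L (M + 'I_n) :=
  let: (i, j, k) := ijk in let f := nth Bot s k in
  if `[< tp (emul (b j) (a i)) f >] then f else Neg f.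
have phiP i j k : tp (emul (b j) (a i)) (phi (i, j, k)).
  by rewrite /phi; case: asboolP => // /gtypeN.
pose r1 (ie : nat * bool) (v : M + 'I_n) : M + W :=
  match v with inl m => inl m | inr k => inr (ie, k) end.
pose r2 i j (v : M + ('I_n + 'I_n)) : M + W := match v with
  | inl m => inl m | inr (inl k) => inr ((j, true), k)
  | inr (inr k) => inr ((i, false), k) end.
pose psi (t : I) : formula L (M + W) := match t with
  | inl ie => rename (r1 ie) (gdom G)
  | inr ijk => rename (r2 ijk.1.1 ijk.1.2) (product_formula (phi ijk)) end.
pose c (j : unit) (w : W) : C := sval (if w.1.2 then b w.1.1 else a w.1.1) w.2.
have E1 (N : structure L) (e : M -> N) u ie :
    vcat e u \o r1 ie = vcat e (fun k => u (ie, k)).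
  by apply: funext => -[].
have E2 (N : structure L) (e : M -> N) u i j : vcat e u \o r2 i j =
    vcat e (vcat (fun k => u ((j, true), k)) (fun k => u ((i, false), k))).
  by apply: funext => -[//|[]].
(* No limit is involved here: over the one-point index set [realize_limit] just copies the
   conditions from [C] to [M]. In [W], the boolean distinguishes [b] from [a]. *)
have [|x xP] := @realize_limit L M hM C unit (globally [set tt])
  (globally_properfilter (erefl tt : [set tt] tt)) W I psi c.
  case=> [ie|[[i j] k]]; apply: nearW => u; apply/sat_rename.
    by rewrite E1; exact: svalP (if ie.2 then b ie.1 else a ie.1).
  by rewrite E2; apply: (product_formulaC (b j) (a i) _).2; exact: phiP.
have dP ie : sat (gdom G) (vcat id (fun k => x (ie, k))).
  by have /sat_rename := xP (inl ie); rewrite E1.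
pose point ie : gpoints G := exist (fun z => sat (gdom G) (vcat id z)) _ (dP ie).
pose a' i := point (i, false); pose b' j := point (j, true).
have near_F i j :
    `|F (tp_point (gmul (b' j) (a' i))) - F (tp (emul (b j) (a i)))| < eps / 4.
  rewrite distrC; apply: sP => f fs bf.
  have ks : (index f s < size s)%N by rewrite index_mem.
  have /sat_rename := xP (inr (i, j, Ordinal ks)).
  rewrite E2 (product_formulaM (b' j) (a' i)) /phi /= nth_index//.
  by case: asboolP.
(* Two errors of [eps / 4] are lost from [eps]. *)
apply: (sF (eps / 2)); first by lra.
exists b', a' => i j ij; have := H i j ij.
move: (near_F i j) (near_F j i); rewrite /= !ltr_norml !ler_normr.
by move=> /andP[? ?] /andP[? ?] /orP[] ?; apply/orP; [right|left]; lra.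
Qed.

End Transfer.

(** * The quotient by stable functions *)

(** The group axioms are one-sided. Idempotents are trivial, and [gmul g (ginv g)] is one, so left
    inverses are right inverses. *)
Lemma gmulr1 (L : language) (M : structure L) (G : definable_group M)
    (g : gpoints G) : gmul g (gone G) = g.
Proof.
have idem (x : gpoints G) : gmul x x = x -> x = gone G.
  by move=> xx; rewrite -[LHS]gmul1 -(gmulV x) -gmulA xx gmulV.
have mulrV : gmul g (ginv g) = gone G.
  by apply: idem; rewrite gmulA -(gmulA g (ginv g)) gmulV -gmulA gmul1.
by rewrite -(gmulV g) gmulA mulrV gmul1.
Qed.

Lemma cluster_cvg_eq (R : realType) (X : topologicalType) (J : Type)
    (U : set_system J) (u : J -> X) (f : X -> R) (x : X) (alpha : R) {FU : Filter U} :
  continuous f -> cluster (u @ U) x ->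
  f (u j) @[j --> U] --> alpha -> f x = alpha.
Proof.
move=> cf xcl fu; symmetry; apply: Rhausdorff => A B nA nB.
have [|z [Az Bz]] := xcl (f @^-1` A) (f @^-1` B) _ (cf x B nB).
  exact: (fu A nA).
by exists (f z).
Qed.

Lemma separate_points (R : realType) (Y : topologicalType) (x y : Y) :
  compact [set: Y] -> hausdorff_space Y ->
  (forall f : Y -> R, continuous f -> f x = f y) -> x = y.
Proof.
move=> cY hY H; apply: contrapT => xy.
have closed1 (z : Y) : closed [set z].
  by apply/accessible_closed_set1/hausdorff_accessible.
have : uniform_separator [set x] [set y].
  move/normal_separatorP : (compact_normal hY cY); apply => //.
  by rewrite -subset0 => z [-> ].
move=> /(@uniform_separatorP _ R)[f [cf _ f0 f1]].
have fx : f x = 0 by apply: f0; exists x.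
have fy : f y = 1 by apply: f1; exists y.
by have := H f cf; rewrite fx fy => /eqP; rewrite eq_sym oner_eq0.
Qed.

Section StableSpace.
Variables (R : realType) (L : language) (M : structure L).
Variables (hM : omega1_saturated M) (G : definable_group M) (C : extension M).

Notation X := (stable_space R G C).
Notation cls := (@stable_class R L M G C).

Lemma stable_classP (p q : gtype G) :
  cls p = cls q <->
  forall F : gtype G -> R, continuous F -> stable_CL C F -> F p = F q.
Proof.
split=> [/eqquotP/asboolP//|H].
by apply/eqquotP/asboolP.
Qed.

Lemma stable_class_repr (x : X) : exists p, x = cls p.
Proof. by exists (repr x); rewrite /stable_class reprK. Qed.

Lemma continuous_stable_class : continuous cls.
Proof. exact: pi_continuous. Qed.

Lemma continuous_stable_space (Z : topologicalType) (f : X -> Z) :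
  continuous (f \o cls) -> continuous f.
Proof. by move=> cf; apply/quotient_continuous. Qed.

Lemma stable_CL_lift (F : gtype G -> R) : continuous F -> stable_CL C F ->
  exists2 f : X -> R, continuous f & forall p, f (cls p) = F p.
Proof.
move=> cF sF; have E p : F (repr (cls p)) = F p.
  have : cls (repr (cls p)) = cls p by rewrite /stable_class reprK.
  by move/stable_classP; exact.
exists (fun x : X => F (repr x)) => //; apply: continuous_stable_space.
by rewrite (_ : _ \o _ = F) //; apply: funext => p /=; rewrite E.
Qed.

Lemma compact_stable_space : compact [set: X].
Proof.
have -> : [set: X] = range cls.
  by apply/seteqP; split=> // x _; have [p ->] := stable_class_repr x; exists p.
apply: continuous_compact (@compact_gtype L M G).
by apply: continuous_subspaceT; exact: continuous_stable_class.
Qed.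

(** Stable functions descend to continuous functions on the quotient and by construction separate
    its points. *)
Lemma hausdorff_stable_space : hausdorff_space X.
Proof.
move=> x y xy.
have [p xp] := stable_class_repr x; have [q yq] := stable_class_repr y.
rewrite xp yq; apply/stable_classP => F cF sF.
have [f cf fE] := stable_CL_lift cF sF.
rewrite -!fE -xp -yq; symmetry.
exact: (@cluster_cvg_eq R X X (nbhs x) id f y _ _ cf xy (cf x)).
Qed.

Lemma stable_on_points_gact (F : gtype G -> R) (g : gpoints G) :
  stable_on_points F -> stable_on_points (F \o gact g).
Proof.
move=> sF eps eps0 [a [b H]]; apply: (sF eps eps0).
exists (fun i => gmul g (a i)), b => i j /H.
by rewrite /= !gact_tp_point !gmulA.
Qed.

(** Independence of the representative: translating a stable [F] by [g] only permutes the rows of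
    its matrix on G(M), so the translate is stable there and, by saturation, on G(C). *)
Lemma stable_actE (g : gpoints G) (p : gtype G) :
  stable_act g (cls p) = cls (gact g p).
Proof.
have : cls (repr (cls p)) = cls p by rewrite /stable_class reprK.
move=> /stable_classP H; apply/stable_classP => F cF sF.
apply: (H (F \o gact g)).
  by move=> q; apply: continuous_comp; [exact: continuous_gact|exact: cF].
apply: stable_on_points_CL => //.
  by move=> q; apply: continuous_comp; [exact: continuous_gact|exact: cF].
by apply: stable_on_points_gact; exact: stable_CL_on_points sF.
Qed.

Lemma stable_space_ambit : is_ambit (@stable_act R L M G C) (stable_base R G C).
Proof.
split; first split.
- exact: compact_stable_space.
- exact: hausdorff_stable_space.
- by move=> x; have [p ->] := stable_class_repr x; rewrite stable_actE gact_one.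
- move=> g h x; have [p ->] := stable_class_repr x.
  by rewrite !stable_actE gact_mul.
- move=> g; apply: continuous_stable_space.
  rewrite (_ : _ \o _ = cls \o gact g); last first.
    by apply: funext => p /=; rewrite stable_actE.
  move=> p; apply: continuous_comp; first exact: continuous_gact.
  exact: continuous_stable_class.
move=> S [x Sx] oS; have [p xp] := stable_class_repr x.
have [||q [Sq [g _ gq]]] := @dense_tp_point L M G (cls @^-1` S).
- by exists p; rewrite /= -xp.
- by move/continuousP: continuous_stable_class; exact.
exists (cls q); split=> //; exists g => //.
by rewrite /stable_base stable_actE gact_tp_point gmulr1 gq.
Qed.

(** For [a] in G(M) the condition phi(xa) is a formula over [M], which [q] decides. *)
Lemma right_translate_cvg (q : gtype G) (a : gpoints G) :
  exists r : gtype G, tp_point (gmul g a) @[g --> tfilter q] --> r.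
Proof.
have [|r [_ rcl]] := @compact_gtype L M G
  (tp_point (gmul g a) @[g --> tfilter q]) _; first exact: filterT.
exists r; apply: gtype_cvg => phi rphi.
pose h (v : M + ('I_(gdim G) + 'I_(gdim G))) : M + 'I_(gdim G) := match v with
  | inl m => inl m | inr (inl k) => inr k | inr (inr k) => inl (sval a k) end.
pose psi := rename h (product_formula phi).
have psiP (g : gpoints G) : sat psi (vcat id (sval g)) <-> tp_point (gmul g a) phi.
  rewrite sat_rename tp_pointE -product_formulaM.
  by split; congr (sat _ _); apply: funext => -[//|[]].
have [qpsi|qpsi] := gtype_complete q psi.
  by exists psi => // g /psiP.
have [|s [ns sphi]] := rcl [set s : gtype G | ~ s phi] _ _ (nbhs_gtype rphi).
  by exists (Neg psi) => // g /sat_Neg npsi /psiP.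
by [].
Qed.

(* Right translation by a point of G(M) is continuous on types, so that the
   limits in [g] of F(ga) exist; exchanging limits then yields that of F(gp). *)
Lemma stable_cvg (F : gtype G -> R) (p q : gtype G) :
  continuous F -> stable_on_points F ->
  exists alpha : R, F (gact g p) @[g --> tfilter q] --> alpha.
Proof.
move=> cF sF; have [V [VU Vp]] := ultraFilterLemma (tfilter_proper p).
have /choice[r rP] := right_translate_cvg q.
have [s rs] := compact_ultra_cvg r (@compact_gtype L M G) VU.
exists (F s).
apply: (@double_limit R _ _ (fun a g => F (tp_point (gmul g a))) V (tfilter q)
  (fun a => F (r a)) (fun g => F (gact g p)) (F s) _ _ _ _ _ _).
- exact: stable_matrix_swap.
- by move=> a; exact: cvg_comp (rP a) (cF (r a)).
- move=> g; rewrite (_ : (fun a => _) = F \o gact g \o @tp_point L M G); last first.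
    by apply: funext => a /=; rewrite gact_tp_point.
  have Vtp : @tp_point L M G @ V --> p.
    by move=> S /(@tfilter_tp_point _ _ _ p) /Vp.
  exact: cvg_comp (cvg_comp _ _ Vtp (@continuous_gact _ _ _ g p)) (cF _).
- exact: cvg_comp rs (cF s).
Qed.

(** By [cvg_definable_map] it suffices that orbit maps converge at each type. A cluster point exists
    by compactness; it is unique because each stable function has a limit by [stable_cvg] and these
    functions separate classes. *)
Lemma stable_space_definable : definable_flow (@stable_act R L M G C).
Proof.
move=> x; have [p ->] := stable_class_repr x; apply: cvg_definable_map => q.
have [|y [_ ycl]] := compact_stable_space
  (F := stable_act g (cls p) @[g --> tfilter q]) _; first exact: filterT.
exists y; apply: (@compact_cluster_set1 _ _ _ setT hausdorff_stable_space
  compact_stable_space) => //; try exact: filterT.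
apply/seteqP; split=> [z zcl|_ -> //].
have [r zr] := stable_class_repr z; have [s ys] := stable_class_repr y.
rewrite zr ys; apply/stable_classP => F cF sF.
have [f cf fE] := stable_CL_lift cF sF.
have [alpha lim] := stable_cvg p q cF (stable_CL_on_points sF).
have flim : f (stable_act g (cls p)) @[g --> tfilter q] --> alpha.
  rewrite (_ : (fun g => _) = fun g => F (gact g p)) //.
  by apply: funext => g; rewrite stable_actE fE.
by rewrite -!fE -zr -ys (cluster_cvg_eq cf zcl flim) (cluster_cvg_eq cf ycl flim).
Qed.

Lemma eq_on_points (Y : topologicalType) (f g : gtype G -> Y) :
  hausdorff_space Y -> continuous f -> continuous g ->
  (forall a, f (tp_point a) = g (tp_point a)) -> f = g.
Proof.
move=> hY cf cg E; apply: funext => p; apply: hY => A B nA nB.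
have lim (k : gtype G -> Y) : continuous k -> k (tp_point a) @[a --> tfilter p] --> k p.
  by move=> ck; exact: cvg_comp (@tfilter_tp_point _ _ _ p) (ck p).
have /filter_ex[a [Aa Ba]] : \forall a \near tfilter p,
    A (f (tp_point a)) /\ B (g (tp_point a)).
  by apply: filterI; [exact: (lim f cf _ nA)|exact: (lim g cg _ nB)].
by exists (f (tp_point a)); split=> //; rewrite E.
Qed.

Lemma stable_space_universal (Y : topologicalType) (act : gpoints G -> Y -> Y)
    (y0 : Y) : definable_ambit act y0 ->
  ambit_maps_onto (@stable_act R L M G C) (stable_base R G C) act y0.
Proof.
move=> [[fY dense_y0] dY]; have [cY hY act1 actM cact] := fY.
have [H cH HE] := definable_map_extension cY hY (dY y0).
(* Each continuous [f] on [Y] pulls back along [H] to a stable function, and such [f] separate the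
   points of [Y]. *)
have Hcls (p q : gtype G) : cls p = cls q -> H p = H q.
  move=> /stable_classP pq; apply: (@separate_points R) => // f cf.
  apply: (pq (f \o H)).
    by move=> r; apply: continuous_comp; [exact: cH|exact: cf].
  apply: stable_on_points_CL => //.
    by move=> r; apply: continuous_comp; [exact: cH|exact: cf].
  have := definable_flow_stable hM (y0 := y0) fY dY cf.
  rewrite /stable_on_points; congr stable_matrix.
  by apply: funext => g; apply: funext => h; rewrite /= HE.
have reprE p : H (repr (cls p)) = H p.
  by apply: Hcls; rewrite /stable_class reprK.
exists (fun x : X => H (repr x)); split.
- apply: continuous_stable_space.
  by rewrite (_ : _ \o _ = H) //; apply: funext => p /=.
- move=> y _.
  (* Surjectivity: the image is closed and contains the dense orbit of [y0]. *)
  have closedH : closed (range H).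
    apply: compact_closed => //; apply: continuous_compact (@compact_gtype L M G).
    by apply: continuous_subspaceT; exact: cH.
  have [p _ <-] : range H y.
    apply: closedH => B /nbhs_interior nB.
    have [|z [Bz [g _ gz]]] := dense_y0 B° _ (open_interior B).
      by exists y; exact: nbhs_singleton.
    exists z; split; last exact: interior_subset.
    by exists (tp_point g); rewrite // HE.
  by exists (cls p).
- move=> g x; have [p ->] := stable_class_repr x.
  rewrite stable_actE !reprE.
  have : H \o gact g = act g \o H.
    apply: eq_on_points => //.
    + by move=> q; apply: continuous_comp; [exact: continuous_gact|exact: cH].
    + by move=> q; apply: continuous_comp; [exact: cH|exact: cact].
    + by move=> a; rewrite /= gact_tp_point !HE actM.
  by move/(congr1 (fun k => k p)).
- by rewrite reprE HE act1.
Qed.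

End StableSpace.

Theorem corollary4p18 (R : realType) (L : language) (M : structure L)
    (hM : omega1_saturated M) (G : definable_group M)
    (C : extension M) (hC : monster C) :
  [/\ forall (g : gpoints G) (p : gtype G),
        stable_act g (stable_class R C p) = stable_class R C (gact g p),
      universal_definable_wap_ambit R (@stable_act R L M G C)
        (stable_base R G C),
      universal_definable_ambit (@stable_act R L M G C) (stable_base R G C)
    & forall (X : topologicalType) (act : gpoints G -> X -> X) (x0 : X),
        universal_definable_wap_ambit R act x0 <->
        universal_definable_ambit act x0].
Proof.
have ambitE (Y : topologicalType) (act : gpoints G -> Y -> Y) (y0 : Y) :
    definable_wap_ambit R act y0 <-> definable_ambit act y0.
  by split=> [[]|]; [split|exact: definable_ambit_wap].
(* Both universal properties quantify over the same ambits, by [ambitE]. *)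
have univE (Y : topologicalType) (act : gpoints G -> Y -> Y) (y0 : Y) :
    universal_definable_wap_ambit R act y0 <-> universal_definable_ambit act y0.
  by split=> -[/ambitE dY H]; split=> // Z actZ z0 /ambitE; exact: H.
have univ : universal_definable_ambit (@stable_act R L M G C) (stable_base R G C).
  split; first by split; [exact: stable_space_ambit|exact: stable_space_definable].
  by move=> Y act y0; exact: stable_space_universal.
by split=> //; [move=> g p; exact: stable_actE|exact/univE].
Qed.
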